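(* Let $\mathfrak g$ be a complex classical simple Lie algebra and let $\mathfrak n$ be the nilradical of a minimal parabolic subalgebra of the split real form of $\mathfrak g$. Assume $\dim\mathfrak n\ge 2$. Then the following conditions are equivalent: (1) every even-dimensional trivial extension $\mathbb R^s\oplus\mathfrak n$ ($s\ge0$ an integer with $s+\dim\mathfrak n$ even) is symplectic; (2) $E_\infty^{0,2}(\mathfrak n)\ne 0$; (3) $\mathfrak g$ is (isomorphic to) $\mathfrak{sl}(3,\mathbb C)$ or $\mathfrak{so}(5,\mathbb C)$.
   Context: The complex classical simple Lie algebras are, up to isomorphism, $\mathfrak{sl}(n+1,\mathbb C)$ ($n\ge1$), $\mathfrak{so}(2n+1,\mathbb C)$ ($n\ge2$), $\mathfrak{sp}(2n,\mathbb C)$ ($n\ge3$; rank $n$), $\mathfrak{so}(2n,\mathbb C)$ ($n\ge4$). Given a complex semisimple Lie algebra $\mathfrak g$ with a Cartan subalgebra and a choice of positive roots $\triangle^+$, the complex nilpotent Lie algebra $\bigoplus_{\alpha\in\triangle^+}\mathfrak g_\alpha$ has a basis $\{X_\alpha\}_{\alpha\in\triangle^+}$ with $\mathfrak g_\alpha=\mathbb C X_\alpha$ and real structure constants (e.g. from a Chevalley basis). The real nilpotent Lie algebra $\mathfrak n$ with basis $\{X_\alpha\}_{\alpha\in\triangle^+}$ and these structure constants is the nilradical of the minimal parabolic subalgebra of the split real form of $\mathfrak g$; up to isomorphism it depends only on $\mathfrak g$. $\mathbb R^s\oplus\mathfrak n$ is the direct sum of $\mathfrak n$ with the abelian Lie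 algebra $\mathbb R^s$. A real Lie algebra is symplectic if it admits a 2-form that is non-degenerate and closed for the Chevalley–Eilenberg differential $d$ (trivial real coefficients), where $$dc(x_1,\dots,x_{p+1})=\sum_{1\le i<j\le p+1}(-1)^{i+j-1}c([x_i,x_j],x_1,\dots,\hat{x_i},\dots,\hat{x_j},\dots,x_{p+1}).$$ Let $\mathfrak n$ be a nilpotent real Lie algebra with central descending series $\mathfrak n^0=\mathfrak n$, $\mathfrak n^i=[\mathfrak n,\mathfrak n^{i-1}]$ and nilpotency index $k$ ($\mathfrak n^k=0$, $\mathfrak n^{k-1}\neq0$). Put $V_0=0$ and $V_i=\{\alpha\in\mathfrak n^*:d\alpha\in\Lambda^2V_{i-1}\}$ for $i\ge1$; $V_i$ is the annihilator of $\mathfrak n^i$. The subcomplexes $F^pC^*=\Lambda^*V_{k-p}$ filter the Chevalley–Eilenberg complex, and $E_\infty^{p,q}(\mathfrak n)$ denote the limit terms of the resulting spectral sequence. In particular $$E_\infty^{0,2}(\mathfrak n)\cong\frac{\{x\in\Lambda^2\mathfrak n^*:dx=0\}}{\{x\in\Lambda^2V_{k-1}:dx=0\}} .$$ *)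

(* Defs.v *)
From HB Require Import structures.
From mathcomp Require Import all_boot all_order all_algebra.
From mathcomp Require Import complex reals.

Set Implicit Arguments.
Unset Strict Implicit.
Unset Printing Implicit Defensive.

Import GRing.Theory.
Local Open Scope ring_scope.

Record lieAlg (K : fieldType) := LieAlg {
  lie_sort :> vectType K;
  lie_br : lie_sort -> lie_sort -> lie_sort;
  lie_br_linearl : forall a x y z,
    lie_br (a *: x + y) z = a *: lie_br x z + lie_br y z;
  lie_br_linearr : forall a x y z,
    lie_br z (a *: x + y) = a *: lie_br z x + lie_br z y;
  lie_brxx : forall x, lie_br x x = 0;
  lie_jacobi : forall x y z,
    lie_br x (lie_br y z) + lie_br y (lie_br z x) + lie_br z (lie_br x y) = 0
}.

Notation "[ 'lie' x , y ]" := (lie_br x y)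
  (at level 0, format "[ 'lie'  x ,  y ]") : ring_scope.

Notation dual V := 'Hom(V, _^o).

Section Constructions.
Variable K : fieldType.

Section Abelian.
Variable s : nat.
Let br0 (x y : 'rV[K]_s) : 'rV[K]_s := 0.
Fact abelian_linearl a x y z : br0 (a *: x + y) z = a *: br0 x z + br0 y z.
Proof. by rewrite /br0 scaler0 addr0. Qed.
Fact abelian_linearr a x y z : br0 z (a *: x + y) = a *: br0 z x + br0 z y.
Proof. by rewrite /br0 scaler0 addr0. Qed.
Fact abelian_xx x : br0 x x = 0. Proof. by []. Qed.
Fact abelian_jacobi x y z :
  br0 x (br0 y z) + br0 y (br0 z x) + br0 z (br0 x y) = 0.
Proof. by rewrite /br0 !addr0. Qed.

Definition abelian_lie : lieAlg K :=
  LieAlg abelian_linearl abelian_linearr abelian_xx abelian_jacobi.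
End Abelian.

Section Product.
Variables L1 L2 : lieAlg K.
Let brP (x y : L1 * L2) : L1 * L2 := ([lie x.1, y.1], [lie x.2, y.2]).
Fact lie_prod_linearl a x y z : brP (a *: x + y) z = a *: brP x z + brP y z.
Proof. by rewrite /brP /= !lie_br_linearl. Qed.
Fact lie_prod_linearr a x y z : brP z (a *: x + y) = a *: brP z x + brP z y.
Proof. by rewrite /brP /= !lie_br_linearr. Qed.
Fact lie_prod_xx x : brP x x = 0.
Proof. by rewrite /brP !lie_brxx. Qed.
Fact lie_prod_jacobi x y z :
  brP x (brP y z) + brP y (brP z x) + brP z (brP x y) = 0.
Proof.
transitivity ([lie x.1, [lie y.1, z.1]] + [lie y.1, [lie z.1, x.1]]
                + [lie z.1, [lie x.1, y.1]],
              [lie x.2, [lie y.2, z.2]] + [lie y.2, [lie z.2, x.2]]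
                + [lie z.2, [lie x.2, y.2]]) => //.
by rewrite !lie_jacobi.
Qed.

Definition lie_prod : lieAlg K :=
  LieAlg lie_prod_linearl lie_prod_linearr lie_prod_xx lie_prod_jacobi.
End Product.
End Constructions.

Definition trivial_extension (K : fieldType) (s : nat) (L : lieAlg K) :=
  lie_prod (abelian_lie K s) L.

Section ChevalleyEilenberg.
Variables (K : fieldType) (L : lieAlg K).

(* A p-form is evaluated on families x : {ffun 'I_p -> L}; that such a function
   is multilinear and alternating is expressed by membership in ext_pow. *)
Definition cochain (p : nat) := {ffun 'I_p -> L} -> K.

(* Lambda^p V for a subspace V of the dual: the span of the wedge products
   (a_0 /\ ... /\ a_(p-1)) (x_0, ..., x_(p-1)) = det (a_i (x_j)) with a_i in V. *)
Definition ext_pow (V : dual L -> Prop) (p : nat) (c : cochain p) : Prop :=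
  exists m (b : 'I_m -> K) (a : 'I_m -> 'I_p -> dual L),
    (forall t i, V (a t i)) /\
    (forall x, c x =
       \sum_(t < m) b t * \det (\matrix_(i < p, j < p) (a t i (x j) : K))).

Definition is_form (p : nat) (c : cochain p) : Prop :=
  ext_pow (fun=> True) c.

Definition ffcons (p : nat) (u : L) (x : {ffun 'I_p -> L}) :
    {ffun 'I_p.+1 -> L} :=
  [ffun l => if unlift ord0 l is Some l' then x l' else u].

(* The sum is over 0 <= i < j <= p, so (-1)^(i+j+1) is the sign (-1)^(i+j-1)
   of the 1-based indexing. For i < j in 'I_p.+1, i is lift j i' with i' of the
   same value, and l |-> lift j (lift i' l) enumerates the indices other than
   i and j. The differential of a 0-form is 0. *)
Definition ce_diff (p : nat) : cochain p -> cochain p.+1 :=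
  match p with
  | 0 => fun _ _ => 0
  | p'.+1 => fun c x =>
      \sum_(j < p'.+2) \sum_(i < p'.+1 | (i < j)%N)
        (-1) ^+ (i + j + 1)%N *
        c (ffcons [lie x (lift j i), x j] [ffun l => x (lift j (lift i l))])
  end.

Definition closed_form (p : nat) (c : cochain p) : Prop :=
  forall x, ce_diff c x = 0.

Definition form1 (a : dual L) : cochain 1 := fun x => a (x ord0).

Definition eval2 (w : cochain 2) (u v : L) : K :=
  w (ffcons u (ffcons v [ffun=> 0])).

Definition symplectic : Prop :=
  exists w : cochain 2,
    [/\ is_form w, closed_form w
      & forall u, (forall v, eval2 w u v = 0) -> u = 0].

Definition lie_comm (U V : {vspace L}) : {vspace L} :=
  <<[seq [lie u, v] | u <- vbasis U, v <- vbasis V]>>%VS.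

Fixpoint lower_central (i : nat) : {vspace L} :=
  if i is i'.+1 then lie_comm fullv (lower_central i') else fullv.

Definition nilpotency_index (k : nat) : Prop :=
  [/\ (0 < k)%N, lower_central k = 0%VS & lower_central k.-1 <> 0%VS].

Fixpoint Vfilt (i : nat) (a : dual L) : Prop :=
  if i is i'.+1 then ext_pow (Vfilt i') (ce_diff (form1 a)) else a = 0.

(* F^p C^n = Lambda^n V_(k-p), for p in Z; it is 0 for p > k, and everything
   for p <= 0 when k is the nilpotency index. *)
Definition Ffilt (k : nat) (p : int) (n : nat) (c : cochain n) : Prop :=
  if (p <= k%:Z)%R then ext_pow (Vfilt `|k%:Z - p|%N) c else forall x, c x = 0.

(* The spectral sequence of the filtered complex, indexed by the filtration
   degree p and the total degree n (so E_r^(p,q) has n = p + q):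
     Z_r^p = F^p C^n :&: d^-1 (F^(p+r) C^(n+1)),
     B_r^p = F^p C^n :&: d (F^(p-r) C^(n-1)),
     E_r^p = Z_r^p / (Z_(r-1)^(p+1) + B_(r-1)^p). *)
Definition ssZ (k r : nat) (p : int) (n : nat) (c : cochain n) : Prop :=
  Ffilt k p c /\ Ffilt k (p + r%:Z) (ce_diff c).

Definition coboundary_of (k : nat) (p : int) (n : nat) : cochain n -> Prop :=
  match n with
  | 0 => fun c => forall x, c x = 0
  | m.+1 => fun c => exists2 b : cochain m,
      Ffilt k p b & forall x, c x = ce_diff b x
  end.

Definition ssB (k r : nat) (p : int) (n : nat) (c : cochain n) : Prop :=
  Ffilt k p c /\ coboundary_of k (p - r%:Z) c.

Definition ssZ_infty (k : nat) (p : int) (n : nat) (c : cochain n) : Prop :=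
  forall r, ssZ k r p c.

Definition ssB_infty (k : nat) (p : int) (n : nat) (c : cochain n) : Prop :=
  exists r, ssB k r p c.

(* The limit term E_infty^(p,n-p) = Z_infty^p / (Z_infty^(p+1) + B_infty^p)
   is nonzero. *)
Definition E_infty_neq0 (k : nat) (p : int) (n : nat) : Prop :=
  exists2 c : cochain n, ssZ_infty k p c &
    ~ exists c1 c2 : cochain n,
        [/\ ssZ_infty k (p + 1) c1, ssB_infty k p c2
          & forall x, c x = c1 x + c2 x].

End ChevalleyEilenberg.

Section MatrixLieAlgebras.
Variable K : fieldType.

(* L is isomorphic to the Lie algebra of the matrices satisfying P, with the
   commutator as bracket. *)
Definition lie_isom_mx (L : lieAlg K) (m : nat) (P : 'M[K]_m -> Prop) : Prop :=
  exists f : {linear L -> 'M[K]_m},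
    [/\ injective f,
        forall x y, f [lie x, y] = f x *m f y - f y *m f x
      & forall A, P A <-> exists x, f x = A].

Definition sl_mx m (A : 'M[K]_m) : Prop := \tr A = 0.

Definition so_mx m (A : 'M[K]_m) : Prop := A^T = - A.

Definition sp_form n : 'M[K]_(n + n) := block_mx 0 1%:M (- 1%:M) 0.

Definition sp_mx n (A : 'M[K]_(n + n)) : Prop :=
  A^T *m sp_form n + sp_form n *m A = 0.

Definition isom_sl (L : lieAlg K) m := lie_isom_mx L (@sl_mx m).
Definition isom_so (L : lieAlg K) m := lie_isom_mx L (@so_mx m).
(* sp(2n) *)
Definition isom_sp (L : lieAlg K) n := lie_isom_mx L (@sp_mx n).

Definition classical_simple (L : lieAlg K) : Prop :=
  [\/ exists2 n, (1 <= n)%N & isom_sl L n.+1,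
      exists2 n, (2 <= n)%N & isom_so L (2 * n).+1%N,
      exists2 n, (3 <= n)%N & isom_sp L n
    | exists2 n, (4 <= n)%N & isom_so L (2 * n)%N].

End MatrixLieAlgebras.

Section RootDecomposition.
Variables (K : fieldType) (g : lieAlg K).

Definition abelian_sub (h : {vspace g}) : Prop :=
  {in h &, forall x y, [lie x, y] = 0}.

(* K is algebraically closed in the intended use: ad x is semisimple. *)
Definition ad_diagonalizable (x : g) : Prop :=
  exists2 b : seq g, <<b>>%VS = fullv
    & {in b, forall y, exists l : K, [lie x, y] = l *: y}.

(* Cartan subalgebras of a complex semisimple Lie algebra: maximal abelian
   subalgebras all of whose elements are ad-semisimple. *)
Definition cartan_subalgebra (h : {vspace g}) : Prop :=
  [/\ abelian_sub h,
      forall h' : {vspace g}, (h <= h')%VS -> abelian_sub h' -> h' = h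
    & {in h, forall x, ad_diagonalizable x}].

Variable h : {vspace g}.

Definition in_root_space (a : dual (subvs_of h)) (x : g) : Prop :=
  forall t : subvs_of h, [lie vsval t, x] = (a t : K) *: x.

Definition is_root (a : dual (subvs_of h)) : Prop :=
  a <> 0 /\ exists2 x, x <> 0 & in_root_space a x.

Definition positive_system (P : dual (subvs_of h) -> Prop) : Prop :=
  [/\ forall a, P a -> is_root a,
      forall a, is_root a -> P a \/ P (- a),
      forall a, ~ (P a /\ P (- a))
    & forall a b, P a -> P b -> is_root (a + b) -> P (a + b)].

End RootDecomposition.

(* R is the field of real numbers and R[i] that of complex numbers.
   n is a real Lie algebra with a basis x_i indexed by the positive roots
   alpha_i of g for some Cartan subalgebra h, and with the structure constants
   c, assumed real, of some root vectors X_i with g_(alpha_i) = C X_i. *)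
Definition split_nilradical (R : realType) (g : lieAlg R[i]) (n : lieAlg R) :
    Prop :=
  exists (h : {vspace g}) (d : nat) (alpha : d.-tuple (dual (subvs_of h)))
         (X : 'I_d -> g) (c : 'I_d -> 'I_d -> 'I_d -> R) (x : d.-tuple n),
    [/\ cartan_subalgebra h,
        uniq alpha /\ positive_system (fun a => a \in alpha),
        forall i y, in_root_space (tnth alpha i) y <-> y \in <[X i]>%VS,
        forall i j, [lie X i, X j] = \sum_(k < d) (c i j k)%:C%C *: X k
      & basis_of fullv x /\
        forall i j, [lie tnth x i, tnth x j] =
                    \sum_(k < d) c i j k *: tnth x k].

(* Main.v *)
Require Import Defs.
From HB Require Import structures.
From mathcomp Require Import all_boot all_order all_algebra.
From mathcomp Require Import complex reals boolp.
From mathcomp Require Import ring zify.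

(** Condition (2) asks for a closed 2-form [w] on [n] and a [z] in the last
    nonzero term of the lower central series with [w(z, .) <> 0].

    (1) => (2): restrict a symplectic form of [R^s + n] to [n]; a central [z] in
    [[n, n]] is orthogonal to [R^s].

    (2) => (3): as [z] is central and brackets of root vectors are multiples of
    distinct root vectors, some central root vector [X_t] has [w(X_t, .) <> 0].
    For the grading of [g] by the coroot of [t], the root vectors of degree 1 span
    with [X_t] a Heisenberg ideal of [n]. If it has dimension at least 5 then
    [w(X_t, .)] vanishes on it, and on the elements of degree 0 as well, because
    these act on the symplectic quotient by symmetric operators, which are trace
    orthogonal to the skew form [w]. So there are at most two roots of degree 1;
    the elements of [g] centralizing all root vectors of nonzero degree form an
    ideal, hence vanish, which bounds [dim g] by 11 and leaves [sl(3)], [so(5)].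

    (3) => (1): [dim g = r + 2 dim n] with [0 < r <= dim n] forces [dim n] to be 3
    or 4, and every nilpotent algebra of that dimension has symplectic
    even-dimensional trivial extensions.

    Cartan subalgebras need not be conjugated to a standard one: all that is used
    of [g] is that it is simple with an invariant nondegenerate form, the trace
    form of its matrix realization. *)

Set Implicit Arguments.
Unset Strict Implicit.
Unset Printing Implicit Defensive.

Import Order.TTheory GRing.Theory Num.Theory.
Local Open Scope ring_scope.

(** * Brackets, 2-forms and the spectral sequence *)

(** For an arbitrary Cartan subalgebra nothing is known beforehand about integrality, simple roots
    or the shape of the root system. The vector H_t = [X_t, Y_t], where Y_t has weight -a_t and
    B(X_t, Y_t) = 1, is kept unnormalized: c = a_t(H_t) is only shown to be nonzero, and strings
    give 2 b(H_t) = k c with k a natural number, which replaces integrality. With degrees 2 b(H_t) /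
    c, centrality of X_t leaves degrees 0 and 1 for the positive roots other than a_t. The constant
    11 is 3 + 2 * 2 + 2 ^ 2: the vectors X_t, Y_t, H_t, the root vectors of degree 1 and -1, and the
    brackets [X_i, Y_j] with i, j of degree 1. Two roots of degree 1 escape the cocycle argument
    because it tests a root vector against a pair of the Heisenberg algebra that does not contain
    it. Real scalars matter in dimension 4, where nondegeneracy amounts to p^2 + q^2 being
    nonzero. *)

Section LieBasics.
Variables (K : fieldType) (L : lieAlg K).
Implicit Types x y z : L.

Fact lie_br_linear z : linear (lie_br z).
Proof. by move=> a x y; rewrite lie_br_linearr. Qed.
HB.instance Definition _ z :=
  GRing.isLinear.Build K L L _ (@lie_br K L z) (lie_br_linear z).

Definition lie_brl z x := [lie x, z].
Fact lie_brl_linear z : linear (lie_brl z).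
Proof. by move=> a x y; rewrite /lie_brl lie_br_linearl. Qed.
HB.instance Definition _ z :=
  GRing.isLinear.Build K L L _ (lie_brl z) (lie_brl_linear z).

Lemma lie_br0r z : [lie z, 0] = 0. Proof. exact: linear0. Qed.
Lemma lie_br0l z : [lie 0, z] = 0. Proof. exact: (linear0 (lie_brl z)). Qed.
Lemma lie_brDr z x y : [lie z, x + y] = [lie z, x] + [lie z, y].
Proof. exact: linearD. Qed.
Lemma lie_brDl z x y : [lie x + y, z] = [lie x, z] + [lie y, z].
Proof. exact: (linearD (lie_brl z)). Qed.
Lemma lie_brZr z a x : [lie z, a *: x] = a *: [lie z, x].
Proof. exact: linearZ. Qed.
Lemma lie_brZl z a x : [lie a *: x, z] = a *: [lie x, z].
Proof. exact: (linearZ_LR (lie_brl z)). Qed.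
Lemma lie_brNr z x : [lie z, - x] = - [lie z, x].
Proof. exact: linearN. Qed.
Lemma lie_br_sumr I (r : seq I) (P : pred I) z (F : I -> L) :
  [lie z, \sum_(i <- r | P i) F i] = \sum_(i <- r | P i) [lie z, F i].
Proof. exact: linear_sum. Qed.
Lemma lie_br_suml I (r : seq I) (P : pred I) z (F : I -> L) :
  [lie \sum_(i <- r | P i) F i, z] = \sum_(i <- r | P i) [lie F i, z].
Proof. exact: (linear_sum (lie_brl z)). Qed.

Lemma lie_brC x y : [lie x, y] = - [lie y, x].
Proof.
have := lie_brxx (x + y).
rewrite lie_brDl !lie_brDr !lie_brxx addr0 add0r => /eqP.
by rewrite addr_eq0 => /eqP.
Qed.

Lemma lie_leibniz x y z :
  [lie x, [lie y, z]] = [lie [lie x, y], z] + [lie y, [lie x, z]].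
Proof.
have := lie_jacobi x y z.
rewrite (lie_brC z [lie x, y]) (lie_brC z x) lie_brNr => e.
by apply/eqP; rewrite -subr_eq0 -e opprD addrA addrAC.
Qed.

End LieBasics.

(** * Alternating bilinear forms and 2-cochains *)

Section TwoForms.
Variables (K : fieldType) (L : lieAlg K).

(** Curried, unlike [cochain]: the algebra is done on such forms, and [cochain_of] and [eval2]
    translate to and from functions of families. *)
Record alternating (b : L -> L -> K) : Prop := Alternating {
  alt_linearl : forall a x y z, b (a *: x + y) z = a * b x z + b y z;
  alt_linearr : forall a x y z, b z (a *: x + y) = a * b z x + b z y;
  altxx : forall x, b x x = 0
}.

Definition cocycle (b : L -> L -> K) : Prop :=
  forall x y z, b [lie x, y] z + b [lie y, z] x + b [lie z, x] y = 0.

Definition cochain_of (b : L -> L -> K) : cochain L 2 :=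
  fun x => b (x ord0) (x ord_max).

Section Alternating.
Variable b : L -> L -> K.
Hypothesis b_alt : alternating b.

Lemma altDl x y z : b (x + y) z = b x z + b y z.
Proof. by have := alt_linearl b_alt 1 x y z; rewrite scale1r mul1r. Qed.
Lemma altDr x y z : b z (x + y) = b z x + b z y.
Proof. by have := alt_linearr b_alt 1 x y z; rewrite scale1r mul1r. Qed.
Lemma alt0l z : b 0 z = 0.
Proof. by apply: (addrI (b 0 z)); rewrite -altDl !addr0. Qed.
Lemma alt0r z : b z 0 = 0.
Proof. by apply: (addrI (b z 0)); rewrite -altDr !addr0. Qed.
Lemma altZl a x z : b (a *: x) z = a * b x z.
Proof. by rewrite -[a *: x]addr0 (alt_linearl b_alt) alt0l addr0. Qed.
Lemma altZr a x z : b z (a *: x) = a * b z x.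
Proof. by rewrite -[a *: x]addr0 (alt_linearr b_alt) alt0r addr0. Qed.
Lemma altC x y : b x y = - b y x.
Proof.
have := altxx b_alt (x + y).
rewrite altDl !altDr !(altxx b_alt) addr0 add0r => /eqP.
by rewrite addr_eq0 => /eqP.
Qed.
Lemma alt_suml I (r : seq I) (P : pred I) (F : I -> L) z :
  b (\sum_(i <- r | P i) F i) z = \sum_(i <- r | P i) b (F i) z.
Proof. exact: (big_morph (b ^~ z) (fun x y => altDl x y z) (alt0l z)). Qed.
Lemma alt_sumr I (r : seq I) (P : pred I) (F : I -> L) z :
  b z (\sum_(i <- r | P i) F i) = \sum_(i <- r | P i) b z (F i).
Proof. exact: (big_morph (b z) (fun x y => altDr x y z) (alt0r z)). Qed.

End Alternating.

Lemma det2 (A : 'M[K]_2) :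
  \det A = A ord0 ord0 * A ord_max ord_max - A ord0 ord_max * A ord_max ord0.
Proof.
rewrite (expand_det_row _ ord0) !big_ord_recl big_ord0 /cofactor !det_mx11.
rewrite !mxE /= expr0 expr1 mul1r addr0 mulN1r mulrN.
do !congr (_ * _ - _ * _) => //; by congr (A _ _); apply: val_inj.
Qed.

Lemma ext_pow2P (V : dual L -> Prop) (c : cochain L 2) : ext_pow V c ->
  exists m (e : 'I_m -> K) (a1 a2 : 'I_m -> dual L),
    [/\ forall t, V (a1 t), forall t, V (a2 t) &
    forall x, c x = \sum_t e t * ((a1 t (x ord0) : K) * (a2 t (x ord_max) : K)
                               - (a1 t (x ord_max) : K) * (a2 t (x ord0) : K))].
Proof.
case=> m [e [a [Va cE]]].
exists m, e, (fun t => a t ord0), (fun t => a t ord_max); split=> // x.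
by rewrite cE; apply: eq_bigr => t _; rewrite det2 !mxE.
Qed.

Lemma ext_pow2_intro (I : finType) (V : dual L -> Prop) (c : cochain L 2)
    (e : I -> K) (a1 a2 : I -> dual L) :
    (forall t, V (a1 t)) -> (forall t, V (a2 t)) ->
    (forall x, c x = \sum_t e t * ((a1 t (x ord0) : K) * (a2 t (x ord_max) : K)
                             - (a1 t (x ord_max) : K) * (a2 t (x ord0) : K))) ->
  ext_pow V c.
Proof.
move=> V1 V2 cE; exists #|I|, (e \o enum_val).
exists (fun t i => if i == ord0 then a1 (enum_val t) else a2 (enum_val t)).
split=> [t i|x]; first by case: ifP.
rewrite cE (reindex _ (onW_bij _ (@enum_val_bij I))).
by apply: eq_bigr => t _; rewrite det2 !mxE.
Qed.

Lemma ext_pow_sub (V W : dual L -> Prop) p (c : cochain L p) :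
  (forall a, V a -> W a) -> ext_pow V c -> ext_pow W c.
Proof.
by move=> VW [m [e [a [Va cE]]]]; exists m, e, a; split=> // t i; apply/VW/Va.
Qed.

Lemma eval2_cochain_of b x y : eval2 (cochain_of b) x y = b x y.
Proof.
rewrite /eval2 /cochain_of !ffunE /=; congr b.
  by case: unliftP => // j /(congr1 val).
case: unliftP => [j|] /(congr1 val) //= ej; rewrite ffunE.
case: unliftP => [k|] //; move/(congr1 val) => /= ek.
by have := ltn_ord k.
Qed.

Lemma ext_pow_eval2 (V : dual L -> Prop) (c : cochain L 2) x : ext_pow V c ->
  c x = eval2 c (x ord0) (x ord_max).
Proof.
case/ext_pow2P=> m [e [a1 [a2 [_ _ cE]]]].
pose b u v := \sum_t e t * ((a1 t u : K) * (a2 t v : K)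
                            - (a1 t v : K) * (a2 t u : K)).
have cb y : c y = cochain_of b y by rewrite cE.
by rewrite /eval2 !cb -/(eval2 (cochain_of b) _ _) eval2_cochain_of.
Qed.

Lemma form_alternating (V : dual L -> Prop) (c : cochain L 2) : ext_pow V c ->
  alternating (eval2 c).
Proof.
case/ext_pow2P=> m [e [a1 [a2 [_ _ cE]]]].
pose b u v := \sum_t e t * ((a1 t u : K) * (a2 t v : K)
                            - (a1 t v : K) * (a2 t u : K)).
have cb u v : eval2 c u v = b u v.
  by rewrite -(eval2_cochain_of b) /eval2 cE.
split=> [a x y z|a x y z|x]; rewrite !cb.
- rewrite /b mulr_sumr -big_split; apply: eq_bigr => t _ /=.
  by rewrite !linearP /= -!/(GRing.scale _ _) /GRing.scale /=; ring.
- rewrite /b mulr_sumr -big_split; apply: eq_bigr => t _ /=.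
  by rewrite !linearP /= /GRing.scale /=; ring.
by rewrite /b big1 // => t _; ring.
Qed.

Lemma ffcons_ord0 p u (x : {ffun 'I_p -> L}) : ffcons u x ord0 = u.
Proof. by rewrite ffunE; case: unliftP => // j /(congr1 val). Qed.

Lemma ffcons_ord_max u (x : {ffun 'I_1 -> L}) : ffcons u x ord_max = x ord0.
Proof.
rewrite ffunE; case: unliftP => [j _|/(congr1 val) //].
by congr (x _); apply: val_inj; case: j => [[]].
Qed.

(** The pairs (0,1), (0,2), (1,2) carry the signs +, -, +; the minus sign is absorbed by turning
    [x0, x2] into [x2, x0], which gives the cyclic sum. *)
Lemma ce_diff2E (b : L -> L -> K) (x : {ffun 'I_3 -> L}) : alternating b ->
  let x0 := x ord0 in let x1 := x (inord 1) in let x2 := x ord_max in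
  ce_diff (cochain_of b) x =
    b [lie x0, x1] x2 + b [lie x1, x2] x0 + b [lie x2, x0] x1.
Proof.
move=> b_alt /=.
pose y k := x (inord k); have xy i : x i = y i by rewrite /y inord_val.
have inner (j : 'I_3) (i : 'I_2) :
    cochain_of b (ffcons [lie x (lift j i), x j] [ffun l => x (lift j (lift i l))])
    = b [lie y (bump j i), y j] (y (bump j (bump i 0))).
  by rewrite /cochain_of ffcons_ord0 ffcons_ord_max ffunE !xy.
rewrite /ce_diff.
under eq_bigr => j _ do under eq_bigr => i _ do rewrite inner.
under eq_bigr => j _ do rewrite big_mkcond !big_ord_recl big_ord0 /=.
rewrite !big_ord_recl !big_ord0 /= !xy /bump /= inordK // !exprS expr0.
rewrite [lie_br (y 2) (y 0)]lie_brC -scaleN1r (altZl b_alt).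
by ring.
Qed.

Lemma closed_cochain_of (b : L -> L -> K) : alternating b ->
  closed_form (cochain_of b) <-> cocycle b.
Proof.
move=> b_alt; split=> [cb x y z|cb x]; last by rewrite ce_diff2E.
have := cb [ffun i : 'I_3 => nth 0 [:: x; y; z] i].
by rewrite ce_diff2E // !ffunE /= inordK.
Qed.

Lemma closed_form_eval2 (V : dual L -> Prop) (c : cochain L 2) : ext_pow V c ->
  closed_form c <-> cocycle (eval2 c).
Proof.
move=> Vc; rewrite -(closed_cochain_of (form_alternating Vc)).
have e x : c x = cochain_of (eval2 c) x by rewrite (ext_pow_eval2 _ Vc).
rewrite /closed_form /ce_diff.
by split=> cb x; rewrite -[RHS](cb x); apply: eq_bigr => i _;
  apply: eq_bigr => j _; rewrite e.
Qed.

(* The projection along U to a complement of U only sees the classes mod U. *)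
Lemma cochain_of_ext_pow (two_neq0 : 2%:R != 0 :> K) (U : {vspace L})
    (b : L -> L -> K) : alternating b -> {in U, forall u v, b u v = 0} ->
  ext_pow (fun a : dual L => {in U, forall u, a u = 0}) (cochain_of b).
Proof.
move=> b_alt bU.
pose X := vbasis {:L}.
pose e i : dual L := (linfun (coord X i : L -> K^o) \o (\1 - projv U))%VF.
have eE i v : e i v = coord X i (v - projv U v).
  by rewrite comp_lfunE lfunE /= add_lfunE opp_lfunE id_lfunE.
have eU i : {in U, forall u, e i u = 0}.
  by move=> u uU; rewrite eE projv_id // subrr linear0.
have bpr v w : b v w = b (v - projv U v) (w - projv U w).
  have bUr u z : u \in U -> b z u = 0.
    by move=> uU; rewrite altC // bU // oppr0.
  rewrite -{1}(subrK (projv U v) v) -{1}(subrK (projv U w) w).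
  move: (v - _) (w - _) => v' w'.
  rewrite (altDl b_alt) (altDr b_alt) (bUr (projv U w)) ?memv_proj //.
  by rewrite (bU (projv U v)) ?memv_proj // !addr0.
pose I := ('I_(\dim {:L}) * 'I_(\dim {:L}))%type.
(* The sum runs over ordered pairs of indices, so every wedge e_i /\ e_j occurs twice: hence the
   factor 1/2. *)
refine (@ext_pow2_intro I _ _ (fun ij => 2%:R^-1 * b X`_ij.1 X`_ij.2)
         (fun ij => e ij.1) (fun ij => e ij.2) _ _ _).
- by move=> t; apply: eU.
- by move=> t; apply: eU.
move=> x; rewrite /cochain_of.
have bE v w : b v w =
      \sum_(ij : 'I_(\dim {:L}) * 'I_(\dim {:L})) (b X`_ij.1 X`_ij.2 * (e ij.1 v : K))
        * (e ij.2 w : K).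
  rewrite bpr {1}(coord_vbasis (memvf (v - _))) {1}(coord_vbasis (memvf (w - _))).
  rewrite alt_suml // -(pair_bigA _ (fun i j : 'I_(\dim {:L}) => b X`_i X`_j * (e i v : K) *
    (e j w : K))) /=.
  apply: eq_bigr => i _; rewrite alt_sumr //; apply: eq_bigr => j _.
  by rewrite altZl // altZr // !eE; ring.
set v := x ord0; set w := x ord_max.
rewrite (_ : b v w = 2%:R^-1 * (b v w - b w v)); last first.
  by rewrite [b w v]altC //; field.
rewrite (bE v w) (bE w v) -sumrB mulr_sumr; apply: eq_bigr => ij _ /=.
by ring.
Qed.

End TwoForms.

Arguments ce_diff : simpl never.

(** * The lower central series and the limit term *)

Section LowerCentral.
Variables (K : fieldType) (L : lieAlg K).

Lemma mem_lie_comm (U V : {vspace L}) u v :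
  u \in U -> v \in V -> [lie u, v] \in lie_comm U V.
Proof.
move=> uU vV; rewrite (coord_vbasis uU) (coord_vbasis vV) lie_br_suml.
apply: memv_suml => i _; rewrite lie_brZl lie_br_sumr memvZ // memv_suml // => j _.
rewrite lie_brZr memvZ // memv_span //.
by apply/allpairsP; exists ((vbasis U)`_i, (vbasis V)`_j); split=> //=;
  apply: mem_nth; rewrite size_tuple.
Qed.

Lemma lie_comm_sub (U V W : {vspace L}) :
  (forall u v, u \in U -> v \in V -> [lie u, v] \in W) -> (lie_comm U V <= W)%VS.
Proof.
move=> sW; apply/span_subvP => w /allpairsP[[u v] [/= uU vV ->]].
by apply: sW; apply: vbasis_mem.
Qed.

Lemma ce_diff1E (a : cochain L 1) x :
  ce_diff a x = a [ffun=> [lie x ord0, x ord_max]].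
Proof.
rewrite /ce_diff.
under eq_bigr => j _ do rewrite big_mkcond !big_ord_recl big_ord0 /=.
rewrite !big_ord_recl big_ord0 /= !exprS expr0 !addr0 add0r.
rewrite -[RHS]mul1r; congr (_ * a _); first by ring.
apply/ffunP=> i; rewrite (ord1 i) ffcons_ord0 ffunE.
by congr [lie x _, x _]; apply: val_inj.
Qed.

Lemma ext_pow_eq (V : dual L -> Prop) p (c c' : cochain L p) :
  c =1 c' -> ext_pow V c -> ext_pow V c'.
Proof.
by move=> cc' [m [b [a [Va cE]]]]; exists m, b, a; split=> // x; rewrite -cc' cE.
Qed.

Lemma ext_pow0 (V : dual L -> Prop) p (c : cochain L p) :
  (forall x, c x = 0) -> ext_pow V c.
Proof.
move=> c0; exists 0, (fun=> 0), (fun _ _ => 0).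
by split=> [[]|x] //; rewrite big_ord0.
Qed.

Lemma ext_pow_radical (V : dual L -> Prop) (c : cochain L 2) u v :
  ext_pow V c -> (forall a, V a -> a u = 0) -> eval2 c u v = 0.
Proof.
move=> Vc Vu; have := ext_pow_eval2 _ Vc.
case/ext_pow2P: (Vc) => m [e [a1 [a2 [V1 V2 cE]]]] _.
rewrite /eval2 cE big1 // => t _; rewrite ffcons_ord0.
by rewrite !Vu // mulr0 mul0r subr0 mulr0.
Qed.

Hypothesis two_neq0 : 2%:R != 0 :> K.

(** Since da(u, v) = a([u, v]), the vectors of term i lie in the radical of da exactly when a kills
    term i+1. A form in the exterior square of V_i has term i in its radical, and
    [cochain_of_ext_pow] is the converse. *)
Lemma VfiltP i (a : dual L) :
  Vfilt i a <-> {in lower_central L i, forall u, a u = 0}.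
Proof.
elim: i a => [|i IHi] a; rewrite [Vfilt _ _]/= [lower_central _ _]/=.
  split=> [-> u _|a0]; first by rewrite zero_lfunE.
  by apply/lfunP => u; rewrite a0 ?memvf // zero_lfunE.
split=> [da u|a0].
  suff /subvP sub : (lie_comm fullv (lower_central L i) <= lker a)%VS.
    by move/sub; rewrite memv_ker => /eqP.
  apply: lie_comm_sub => v w _ wi; rewrite memv_ker; apply/eqP.
  have := ext_pow_radical v da (fun b bi => (IHi b).1 bi w wi).
  rewrite /eval2 ce_diff1E /form1 ffunE ffcons_ord0 ffcons_ord_max ffcons_ord0.
  by rewrite lie_brC linearN => /eqP; rewrite oppr_eq0 => /eqP.
pose b u v : K := a [lie u, v].
have b_alt : alternating b.
  split=> [e x y z|e x y z|x]; rewrite /b.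
  - by rewrite lie_br_linearl linearP.
  - by rewrite lie_br_linearr linearP.
  by rewrite lie_brxx linear0.
apply: (@ext_pow_sub _ _ (fun d : dual L => {in lower_central L i, forall u, d u = 0})).
  by move=> d /IHi.
apply: (@ext_pow_eq _ _ (cochain_of b)); first by move=> x; rewrite ce_diff1E /form1 ffunE.
apply: cochain_of_ext_pow => // u ui v.
by apply: a0; rewrite lie_brC memvN mem_lie_comm ?memvf.
Qed.

Lemma lower_central_last k (z y : L) :
  nilpotency_index L k -> z \in lower_central L k.-1 -> [lie z, y] = 0.
Proof.
case=> k_gt0 k0 _ zk; apply/eqP; rewrite -memv0 -k0 -(prednK k_gt0) /=.
by rewrite lie_brC memvN mem_lie_comm ?memvf.
Qed.

Lemma Ffilt0 k p n (c : cochain L n) : (forall x, c x = 0) -> Ffilt k p c.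
Proof. by move=> c0; rewrite /Ffilt; case: (_ <= _) => //; apply: ext_pow0. Qed.

(** Evaluation at (z, y) detects the class: a form in the exterior square of V_(k-1) has z in its
    radical, and a coboundary da takes the value a([z, y]) = 0 because z is central. *)
Lemma E_infty_neq0_intro k (b : L -> L -> K) z y :
    nilpotency_index L k -> alternating b -> cocycle b ->
    z \in lower_central L k.-1 -> b z y != 0 ->
  E_infty_neq0 L k 0 2.
Proof.
move=> nk b_alt b_cl zk bzy; have [k_gt0 k0 _] := nk.
have cb : closed_form (cochain_of b) by apply/closed_cochain_of.
exists (cochain_of b).
  move=> r; split; last first.
    by apply: Ffilt0.
  rewrite /Ffilt subr0 /=; apply: (ext_pow_sub (V := fun a : dual L =>
      {in 0%VS, forall u, a u = 0})) => [a _|].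
    by apply/VfiltP; rewrite k0 => u; rewrite memv0 => /eqP->; rewrite linear0.
  by apply: cochain_of_ext_pow => // u; rewrite memv0 => /eqP-> v; rewrite alt0l.
case=> c1 [c2 [/(_ 0%N)[+ _] [r [_ [a Fa c2E]]] cE]].
rewrite /Ffilt add0r lez_nat k_gt0 => c1k.
move/eqP: bzy; apply; rewrite -eval2_cochain_of /eval2 cE.
rewrite -[X in X + _]/(eval2 c1 z y) (ext_pow_radical _ c1k) ?add0r; last first.
  by move=> d /VfiltP; apply; rewrite subzn // subn1.
rewrite c2E ce_diff1E ffcons_ord0 ffcons_ord_max ffcons_ord0.
rewrite (lower_central_last _ nk zk).
move: Fa; rewrite /Ffilt; case: ifP => _ => [[m [e [d [_ ->]]]]|->] //.
by rewrite big1 // => t _; rewrite det_mx11 mxE ffunE linear0 mulr0.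
Qed.

Lemma E_infty_neq0_elim k : nilpotency_index L k -> E_infty_neq0 L k 0 2 ->
  exists b : L -> L -> K, exists z y,
    [/\ alternating b, cocycle b, z \in lower_central L k.-1 & b z y != 0].
Proof.
move=> nk [c Zc Nc]; have [k_gt0 k0 _] := nk.
have [Fc _] := Zc 0%N.
move: Fc; rewrite /Ffilt subr0 /= => Fc.
have c_closed : closed_form c.
  (* For r = k+1 the differential lies in F^(k+1), which is 0. *)
  have [_] := Zc k.+1; rewrite /Ffilt add0r lez_nat ltnn => c0 x; exact: c0.
have c_alt := form_alternating Fc.
exists (eval2 c).
(* If the form vanished on the last nonzero term, c would itself lie in F^1 and be a trivial class,
   with c2 = 0. *)
apply: contrapT => nbzy; apply: Nc; exists c, (fun=> 0); split=> [r||x].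
- split; last by apply: Ffilt0.
  rewrite /Ffilt add0r lez_nat k_gt0.
  apply: (@ext_pow_eq _ _ (cochain_of (eval2 c))).
    by move=> x; rewrite (ext_pow_eval2 _ Fc).
  apply: (ext_pow_sub (V := fun a : dual L =>
      {in lower_central L k.-1, forall u, a u = 0})) => [a ak|].
    by apply/VfiltP; rewrite subzn // subn1.
  apply: cochain_of_ext_pow => // z zk y; apply/eqP/negPn/negP => bzy.
  apply: nbzy; exists z, y; split=> //; exact/(closed_form_eval2 Fc).
- exists 0%N; split; first by apply: Ffilt0.
  exists (fun=> 0); first by apply: Ffilt0.
  by move=> x; rewrite ce_diff1E.
by rewrite addr0.
Qed.

End LowerCentral.

(** * Closed forms on extensions of Heisenberg algebras *)

Section HeisenbergIdeal.
Variables (K : numFieldType) (L : lieAlg K) (I : finType) (x : I -> L).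
Variables (t : I) (S : {set I}) (s : I -> I) (N : I -> K).
Hypothesis xt_neq0 : x t != 0.
Hypothesis sS : {in S, forall i, s i \in S}.
Hypothesis sK : {in S, involutive s}.
Hypothesis N_neq0 : {in S, forall i, N i != 0}.
Hypothesis br_s : {in S, forall i, [lie x i, x (s i)] = N i *: x t}.
Hypothesis br_neq_s : {in S &, forall i j, j != s i -> [lie x i, x j] = 0}.

Variable w : L -> L -> K.
Hypotheses (w_alt : alternating w) (w_cocycle : cocycle w).

(** For b outside {i, s i} the cocycle identity on x_b, x_(s b), x_i has the single nonzero bracket
    [x_b, x_(s b)] = N_b x_t. More than two indices are what provides such a b. *)
Lemma cocycle_heisenberg_self i : (2 < #|S|)%N -> i \in S -> w (x t) (x i) = 0.
Proof.
move=> S_gt2 iS.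
have /card_gt0P[b] : (0 < #|S :\: [set i; s i]|)%N.
  rewrite cardsD subn_gt0 (leq_trans _ S_gt2) // ltnS.
  by rewrite (leq_trans (subset_leq_card (subsetIr _ _))) // cards2; case: (_ == _).
rewrite !inE negb_or => /andP[/andP[bi bsi] bS].
have := w_cocycle (x b) (x (s b)) (x i).
rewrite br_s // (br_neq_s (sS bS) iS); last by rewrite sK // eq_sym.
rewrite (br_neq_s iS bS) // !(alt0l w_alt) !addr0 (altZl w_alt) => /eqP.
by rewrite mulf_eq0 (negPf (N_neq0 bS)) => /eqP.
Qed.

Lemma N_s i : i \in S -> N (s i) = - N i.
Proof.
move=> iS; have := br_s (sS iS); rewrite sK // lie_brC br_s // -scaleNr => /eqP.
by rewrite -subr_eq0 -scalerBl scaler_eq0 (negPf xt_neq0) orbF subr_eq0 => /eqP.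
Qed.

Lemma sum_s (V : nmodType) (F : I -> V) :
  \sum_(i in S) F (s i) = \sum_(i in S) F i.
Proof.
rewrite [RHS](reindex_onto s s) => [|i iS]; last exact: sK.
apply: eq_bigl => i; apply/idP/andP => [iS|[siS /eqP<-]]; last exact: sS.
by rewrite sS ?sK.
Qed.

(* An element y centralizing x_t acts on the span of the x_i, i in S, by an
   infinitesimally symplectic endomorphism, i.e. a symmetric one once the
   symplectic form is used to identify it with a bilinear form. Its trace
   against the skew form w vanishes, so summing the cocycle identity over the
   pairs (x_i, x_(s i)) only leaves #|S| copies of w(x_t, y). *)
Lemma cocycle_heisenberg_normalizer (A : I -> I -> K) (y : L) :
    [lie x t, y] = 0 ->
    {in S, forall j, [lie y, x j] = \sum_(l in S) A l j *: x l} ->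
  (0 < #|S|)%N -> w (x t) y = 0.
Proof.
move=> xty yS S_gt0.
(* The derivation ad y kills x_t, hence also [x_j, x_(s i)]; the coefficient of x_t in the Leibniz
   expansion gives the relation. *)
have adA i j : i \in S -> j \in S -> A i j * N i + A (s j) (s i) * N j = 0.
  move=> iS jS; have siS := sS iS; have sjS := sS jS.
  have : [lie y, [lie x j, x (s i)]] = 0.
    have [->|ne] := eqVneq (s i) (s j); last by rewrite br_neq_s ?lie_br0r.
    by rewrite br_s // lie_brZr lie_brC xty oppr0 scaler0.
  rewrite lie_leibniz !yS // lie_br_suml lie_br_sumr.
  rewrite (bigD1 i) //= big1 ?addr0 => [|l /andP[lS li]]; last first.
    rewrite lie_brZl br_neq_s ?scaler0 //.
    by apply: contra li => /eqP e; rewrite -(sK lS) -e sK.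
  rewrite (bigD1 (s j)) //= big1 ?addr0 => [|l /andP[lS li]]; last first.
    by rewrite lie_brZr br_neq_s ?scaler0.
  rewrite lie_brZl lie_brZr !br_s // !scalerA -scalerDl => /eqP.
  by rewrite scaler_eq0 (negPf xt_neq0) orbF => /eqP.
(* By [adA] the first factor is symmetric under (l, b) |-> (s b, s l), while w is skew; so F changes
   sign and its total sum T vanishes. *)
pose F l b := (N b)^-1 * A l b * w (x l) (x (s b)).
have F_s l b : l \in S -> b \in S -> F (s b) (s l) = - F l b.
  move=> lS bS; rewrite /F sK // N_s // (altC w_alt).
  have Nl := N_neq0 lS; have Nb := N_neq0 bS.
  have -> : A (s b) (s l) = - (A l b * N l) / N b.
    by have /eqP := adA l b lS bS; rewrite addrC addr_eq0 => /eqP <-; rewrite mulfK.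
  by field; rewrite Nl Nb.
pose T := \sum_(b in S) \sum_(l in S) F l b.
have T0 : T = 0.
  suff /eqP : T = - T by rewrite -addr_eq0 -mulr2n mulrn_eq0 => /eqP.
  rewrite /T -[LHS]sum_s exchange_big -sum_s -sumrN; apply: eq_bigr => b bS /=.
  by rewrite -sumrN; apply: eq_bigr => l lS; rewrite F_s // ?sS ?sK.
(* This is the cocycle identity on x_b, x_(s b), y, divided by N_b. *)
have rel b : b \in S ->
    w (x t) y = - (\sum_(l in S) F l b + \sum_(l in S) F l (s b)).
  move=> bS; have sbS := sS bS; have Nb := N_neq0 bS.
  have := w_cocycle (x b) (x (s b)) y.
  rewrite br_s // (lie_brC _ y) !yS // -scaleN1r !(altZl w_alt) !(alt_suml w_alt).
  under eq_bigr => l _ do rewrite (altZl w_alt).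
  under [X in _ + X]eq_bigr => l _ do rewrite (altZl w_alt).
  have -> : \sum_(l in S) F l b = (N b)^-1 * \sum_(l in S) A l b * w (x l) (x (s b)).
    by rewrite mulr_sumr; apply: eq_bigr => l _; rewrite /F mulrA.
  have -> : \sum_(l in S) F l (s b) =
      - (N b)^-1 * \sum_(l in S) A l (s b) * w (x l) (x b).
    by rewrite mulr_sumr; apply: eq_bigr => l _; rewrite /F N_s // sK // invrN mulrA.
  move: (\sum_(l in S) _) (\sum_(l in S) _) => T1 T2 e.
  by apply: (mulfI Nb); apply/eqP; rewrite -subr_eq0 -e; apply/eqP; field.
have : \sum_(b in S) w (x t) y = 0.
  rewrite (eq_bigr _ rel) sumrN big_split /= (sum_s (fun b => \sum_(l in S) F l b)).
  by rewrite -/T T0 addr0 oppr0.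
rewrite sumr_const => /eqP; rewrite mulrn_eq0 -leqn0 leqNgt S_gt0 /=.
by move/eqP.
Qed.

End HeisenbergIdeal.

(** * Symplectic forms in low dimension *)

Section JointlyInjective.
Variables (K : fieldType) (V : vectType K) (I : finType).
Variable z : I -> 'Hom(V, K^o).
Hypothesis z_inj : forall u, (forall i, z i u = 0) -> u = 0.

Let f u : {ffun I -> K^o} := [ffun i => z i u].
Fact joint_linear : linear f.
Proof. by move=> a u v; apply/ffunP=> i; rewrite !ffunE linearP. Qed.
Let fM := GRing.isLinear.Build _ _ _ _ f joint_linear.
Let fL : {linear _ -> _} := HB.pack f fM.

Fact lker_joint : lker (linfun fL) == 0%VS.
Proof.
rewrite -subv0; apply/subvP=> u; rewrite memv_ker lfunE memv0 => /eqP fu0.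
by apply/eqP/z_inj => i; have /ffunP/(_ i) := fu0; rewrite !ffunE.
Qed.

Lemma joint_injective_dim : (\dim {:V} <= #|I|)%N.
Proof.
rewrite -(limg_dim_eq (f := linfun fL)); last by rewrite (eqP lker_joint) capv0.
by rewrite (leq_trans (dimvS (subvf _))) // dimvf /dim /= muln1.
Qed.

Lemma joint_injective_surj (e : I -> K) : \dim {:V} = #|I| ->
  exists u, forall i, z i u = e i.
Proof.
move=> dV.
have : [ffun i => e i : K^o] \in limg (linfun fL).
  suff -> : limg (linfun fL) = fullv by rewrite memvf.
  apply/eqP; rewrite eqEdim subvf limg_dim_eq ?(eqP lker_joint) ?capv0 //.
  by rewrite dV dimvf /dim /= muln1.
case/memv_imgP=> u _; rewrite lfunE => /ffunP eu; exists u => i.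
by have := eu i; rewrite !ffunE.
Qed.

End JointlyInjective.

Section StandardForm.
Variables (K : fieldType) (L : lieAlg K).
Implicit Types (z : nat -> dual L) (m : nat).

(** The Darboux form of the coordinates z, pairing the indices 2i and 2i+1. *)
Definition std_form z m (u v : L) : K :=
  \sum_(0 <= i < m) ((z i.*2 u : K) * (z i.*2.+1 v : K)
                    - (z i.*2.+1 u : K) * (z i.*2 v : K)).

Lemma std_form_alternating z m : alternating (std_form z m).
Proof.
split=> [a x y w|a x y w|x]; rewrite /std_form.
- rewrite mulr_sumr -big_split; apply: eq_bigr => t _ /=.
  by rewrite !linearP /= /GRing.scale /=; ring.
- rewrite mulr_sumr -big_split; apply: eq_bigr => t _ /=.
  by rewrite !linearP /= /GRing.scale /=; ring.
by rewrite big1 // => t _; ring.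
Qed.

(** As many coordinates as dimensions, jointly injective, have a dual basis. Pairing u with the dual
    vector of the partner of j (j-1 or j+1) returns z_j u up to sign. *)
Lemma std_form_symplectic z m : \dim {:L} = m.*2 ->
    (forall u, (forall j, (j < m.*2)%N -> z j u = 0) -> u = 0) ->
    cocycle (std_form z m) ->
  symplectic L.
Proof.
move=> dL z_inj z_cl; exists (cochain_of (std_form z m)); split.
- apply: (@ext_pow2_intro _ _ 'I_m _ _ (fun=> 1) (fun i => z i.*2)
    (fun i => z i.*2.+1)) => // x.
  rewrite /cochain_of /std_form big_mkord; apply: eq_bigr => i _.
  by rewrite mul1r; ring.
- exact/closed_cochain_of/z_cl/std_form_alternating.
move=> u u0; apply: (z_inj) => j lt_j.
have z_inj' v : (forall i : 'I_m.*2, z i v = 0) -> v = 0.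
  by move=> v0; apply: z_inj => i lt_i; apply: (v0 (Ordinal lt_i)).
have dual_vec i : (i < m.*2)%N -> exists v, forall k, (k < m.*2)%N ->
    z k v = (k == i)%:R.
  move=> lt_i; have [|v vE] := joint_injective_surj z_inj'
    (fun k : 'I_m.*2 => (val k == i)%:R); first by rewrite card_ord.
  by exists v => k lt_k; rewrite (vE (Ordinal lt_k)).
have eval_pair v : (forall i, (i < m)%N -> i != j./2 ->
      z i.*2 v = 0 /\ z i.*2.+1 v = 0) ->
    std_form z m u v = (z j./2.*2 u : K) * (z j./2.*2.+1 v : K)
                       - (z j./2.*2.+1 u : K) * (z j./2.*2 v : K).
  move=> v0; rewrite /std_form (bigD1_seq j./2) ?iota_uniq //=; last first.
    by rewrite mem_index_iota; lia.
  rewrite big_seq_cond big1 ?addr0 // => i /andP[].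
  by rewrite mem_index_iota => /v0 im /im[-> ->]; rewrite !mulr0 subr0.
have [jo|je] := boolP (odd j).
  have [|v vE] := dual_vec j.-1; first by lia.
  have := u0 v; rewrite eval2_cochain_of eval_pair => [|i im ij]; last first.
    by rewrite !vE; [split; case: eqP => //; lia|lia|lia].
  rewrite !vE; [|lia|lia].
  have -> : (j./2.*2 == j.-1) by lia.
  have -> : (j./2.*2.+1 == j.-1) = false by lia.
  have -> : j./2.*2.+1 = j by lia.
  by rewrite mulr0 mulr1 sub0r => /eqP; rewrite oppr_eq0 => /eqP.
have [|v vE] := dual_vec j.+1; first by lia.
have := u0 v; rewrite eval2_cochain_of eval_pair => [|i im ij]; last first.
  by rewrite !vE; [split; case: eqP => //; lia|lia|lia].
rewrite !vE; [|lia|lia].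
have -> : (j./2.*2 == j.+1) = false by lia.
have -> : (j./2.*2.+1 == j.+1) by lia.
have -> : j./2.*2 = j by lia.
by rewrite mulr0 mulr1 subr0.
Qed.

End StandardForm.

(** The coordinates of the abelian factor are appended to z; they kill all brackets, so their pairs
    are closed. For odd d the last coordinate of L is paired with the first abelian one, and it has
    to kill brackets too. *)
Lemma trivial_extension_symplectic (K : fieldType) (L : lieAlg K) (s m d : nat)
    (z : nat -> dual L) :
    \dim {:L} = d -> (s + d)%N = m.*2 ->
    (forall u, (forall j, (j < d)%N -> z j u = 0) -> u = 0) ->
    cocycle (std_form z d./2) ->
    (odd d -> forall u v, z d.-1 [lie u, v] = 0) ->
  symplectic (trivial_extension s L).
Proof.
move=> dL dm z_inj z_cl z_odd.
pose E := trivial_extension s L.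
pose f j (x : E) : K^o :=
  if (j < d)%N then z j x.2 else if insub (j - d)%N is Some i then x.1 0 i else 0.
have f_lin j : linear (f j).
  move=> a x y; rewrite /f; case: ifP => _; first by rewrite /= linearP.
  by case: insubP => [i _ _|_] /=; rewrite ?mxE ?scaler0 ?addr0.
pose fM j := GRing.isLinear.Build _ _ _ _ (f j) (f_lin j).
pose fL j : {linear E -> K^o} := HB.pack (f j) (fM j).
pose Z j : dual E := linfun (fL j).
have ZE j x : Z j x = f j x by rewrite lfunE.
apply: (std_form_symplectic (z := Z) (m := m)).
- rewrite dimvf -dm -dL; transitivity (dim 'rV[K]_s + dim L)%N => //.
  by rewrite dimvf; congr addn; exact: etrans (dim_matrix _ _ _) (mul1n _).
- move=> [r u] x0; congr (_, _).
    apply/rowP=> i; have := x0 (d + i)%N; rewrite ZE /f addKn.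
    have -> : (d + i < d)%N = false by lia.
    have lt_im : (d + i < m.*2)%N by have := ltn_ord i; lia.
    by case: insubP => [i' _ /val_inj -> /(_ lt_im)|]; rewrite ?ltn_ord // mxE.
  by apply: z_inj => j jd; have := x0 j; rewrite ZE /f jd; apply; lia.
have Zbr j u v : (d <= j)%N || (odd d && (j == d.-1)) -> Z j [lie u, v] = 0.
  case/orP=> [dj|/andP[od /eqP->]]; rewrite ZE /f.
    by rewrite ltnNge dj /=; case: insubP => [i _ _|//]; rewrite mxE.
  by rewrite ltn_predL odd_gt0 // z_odd.
have Zform (x y w : E) :
    std_form Z m [lie x, y] w = std_form z d./2 [lie x.2, y.2] w.2.
  rewrite /std_form (@big_cat_nat _ _ _ d./2) //=; last by lia.
  rewrite [X in _ + X]big_seq_cond [X in _ + X]big1 ?addr0 => [|i]; last first.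
    by rewrite mem_index_iota => im; rewrite !Zbr ?mul0r ?subr0 //; lia.
  rewrite big_seq_cond [RHS]big_seq_cond; apply: eq_bigr => i.
  rewrite mem_index_iota andbT => im; rewrite !ZE /f.
  have -> : (i.*2 < d)%N by lia.
  by have -> : (i.*2.+1 < d)%N by lia.
by move=> x y w; rewrite !Zform z_cl.
Qed.

(** Nilpotency in coordinates: a bracket of two basis vectors only involves indices above both. *)
Definition triangular_basis (K : fieldType) (L : lieAlg K) d (e : d.-tuple L) :=
  basis_of fullv e /\
  forall i j k : 'I_d, (k <= maxn i j)%N -> coord e k [lie e`_i, e`_j] = 0.

Section LowDimension.
Variables (K : numFieldType) (L : lieAlg K).

Lemma coord_br d (e : d.-tuple L) (x y : L) k : basis_of fullv e ->
  coord e k [lie x, y] =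
    \sum_i \sum_j coord e i x * coord e j y * coord e k [lie e`_i, e`_j].
Proof.
move=> eb; rewrite {1}(coord_basis eb (memvf x)) lie_br_suml linear_sum.
apply: eq_bigr => i _; rewrite lie_brZl linearZ /=.
rewrite {1}(coord_basis eb (memvf y)) lie_br_sumr linear_sum mulr_sumr.
by apply: eq_bigr => j _; rewrite lie_brZr linearZ /= mulrA.
Qed.

Lemma basis_coord_inj d (e : d.-tuple L) (x : L) : basis_of fullv e ->
  (forall i, coord e i x = 0) -> x = 0.
Proof.
move=> eb x0; rewrite (coord_basis eb (memvf x)) big1 // => i _.
by rewrite x0 scale0r.
Qed.

(** Indexed by [nat] so that sums over small index ranges unfold; [inord] sends k > d to 0, so only
    k <= d is meaningful. *)
Definition coord_dual d (e : d.+1.-tuple L) (k : nat) : dual L :=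
  linfun (coord e (inord k) : L -> K^o).

Section Triangular.
Variables (d : nat) (e : d.+1.-tuple L).
Hypothesis e_tri : triangular_basis e.
Let C := coord_dual e.
Let c i j k : K := C k [lie e`_i, e`_j].

Lemma coord_dual_inj x : (forall k, (k < d.+1)%N -> C k x = 0) -> x = 0.
Proof.
move=> x0; apply: (basis_coord_inj e_tri.1) => i.
by rewrite -(x0 i) // lfunE /= inord_val.
Qed.

Lemma coord_dual_br k x y : C k [lie x, y] =
  \sum_(0 <= i < d.+1) \sum_(0 <= j < d.+1) (C i x : K) * (C j y : K) * c i j k.
Proof.
rewrite lfunE /= (coord_br _ _ _ e_tri.1) big_mkord; apply: eq_bigr => i _.
by rewrite big_mkord; apply: eq_bigr => j _; rewrite /c /C !lfunE /= !inord_val.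
Qed.

Lemma structC i j k : c i j k = - c j i k.
Proof. by rewrite /c lie_brC (linearN (C k)). Qed.

Lemma structxx i k : c i i k = 0.
Proof. by rewrite /c lie_brxx linear0. Qed.

Lemma struct0 i j k : (i <= d)%N -> (j <= d)%N -> (k <= maxn i j)%N -> c i j k = 0.
Proof.
move=> id jd kij; have kd : (k <= d)%N by rewrite (leq_trans kij) // geq_max id jd.
rewrite /c lfunE /= -(@inordK d i) // -(@inordK d j) //.
by apply: e_tri.2; rewrite !inordK.
Qed.

End Triangular.

(** Makes the coordinates opaque K-valued functions, so that cocycle identities become polynomial
    identities for [ring]. *)
Lemma coord_fun d (e : d.+1.-tuple L) :
  exists f : nat -> L -> K, forall k u, coord_dual e k u = f k u.
Proof. by exists (fun k u => coord_dual e k u). Qed.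

Lemma dim3_symplectic (e : 3.-tuple L) s : triangular_basis e ->
  odd s -> symplectic (trivial_extension s L).
Proof.
move=> e_tri s_odd; have [f fE] := coord_fun e.
have f_br k x y : (k < 2)%N -> f k [lie x, y] = 0.
  move=> k2; rewrite -fE coord_dual_br // /index_iota /= !big_cons !big_nil.
  by rewrite !structxx !(struct0 e_tri) ?(mulr0, addr0) //; lia.
have [c f2_br] : exists c, forall x y,
    f 2 [lie x, y] = (f 0 x * f 1 y - f 1 x * f 0 y) * c.
  exists (f 2 [lie e`_0, e`_1]) => x y.
  rewrite -fE coord_dual_br // /index_iota /= !big_cons !big_nil.
  rewrite (structC e 1 0) !structxx fE; move: (f 2 [lie e`_0, e`_1]) => c.
  by rewrite !(struct0 e_tri (k := 2)) // !fE; ring.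
have f_inj := coord_dual_inj e_tri.
(* The form is e_0 /\ e_2 plus e_1 /\ (abelian coordinate). It is closed because de_2 is a multiple
   of e_0 /\ e_1 and the other coordinates kill brackets. *)
pose z k := coord_dual e (nth 0%N [:: 0%N; 2%N; 1%N] k).
apply: (@trivial_extension_symplectic _ _ s s.+3./2 3%N z).
- exact: size_basis e_tri.1.
- by lia.
- move=> u u0; apply: f_inj => -[|[|[|//]]] _.
  + exact: (u0 0%N).
  + exact: (u0 2%N).
  + exact: (u0 1%N).
- move=> x y w; rewrite /std_form /index_iota /= !big_cons !big_nil /z /= !fE.
  by rewrite !f2_br !f_br //; ring.
by move=> _ u v; rewrite /z /= fE f_br.
Qed.

(* The closed nondegenerate form is
   e_3 /\ (p e_0 + q e_1) + (q e_0 - p e_1) /\ e_2, in dual coordinates: its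
   differential is, up to sign, (c p - b q) e_0 /\ e_1 /\ e_2 for [e_0, e_2] = b e_3 and
   [e_1, e_2] = c e_3. *)
Lemma dim4_symplectic (e : 4.-tuple L) s :
    (forall p q : K, p ^+ 2 + q ^+ 2 = 0 -> p = 0 /\ q = 0) ->
    triangular_basis e ->
  ~~ odd s -> symplectic (trivial_extension s L).
Proof.
move=> K_real e_tri s_even; have [f fE] := coord_fun e.
have f_br k x y : (k < 2)%N -> f k [lie x, y] = 0.
  move=> k2; rewrite -fE coord_dual_br // /index_iota /= !big_cons !big_nil.
  by rewrite !structxx !(struct0 e_tri) ?(mulr0, addr0) //; lia.
have [a f2_br] : exists a, forall x y,
    f 2 [lie x, y] = (f 0 x * f 1 y - f 1 x * f 0 y) * a.
  exists (f 2 [lie e`_0, e`_1]) => x y.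
  rewrite -fE coord_dual_br // /index_iota /= !big_cons !big_nil.
  rewrite (structC e 1 0) !structxx fE; move: (f 2 [lie e`_0, e`_1]) => a.
  by rewrite !(struct0 e_tri (k := 2)) // !fE; ring.
have [a' [b [c f3_br]]] : exists a' b c, forall x y, f 3 [lie x, y] =
    (f 0 x * f 1 y - f 1 x * f 0 y) * a' + (f 0 x * f 2 y - f 2 x * f 0 y) * b
    + (f 1 x * f 2 y - f 2 x * f 1 y) * c.
  exists (f 3 [lie e`_0, e`_1]), (f 3 [lie e`_0, e`_2]), (f 3 [lie e`_1, e`_2]).
  move=> x y; rewrite -fE coord_dual_br // /index_iota /= !big_cons !big_nil.
  rewrite (structC e 1 0) (structC e 2 0) (structC e 2 1) !structxx !fE.
  move: (f 3 [lie e`_0, e`_1]) (f 3 [lie e`_0, e`_2]) (f 3 [lie e`_1, e`_2]).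
  by move=> a' b c; rewrite -!fE !(struct0 e_tri (k := 3)) // !fE; ring.
(* Take (p, q) = (b, c) unless both vanish. The value p^2 + q^2 is, up to sign, the determinant
   expressing z_1, z_2 in the coordinates 0 and 1. *)
have [p [q [pq_neq0 pq]]] : exists p q : K, p ^+ 2 + q ^+ 2 != 0 /\ c * p = b * q.
  have [e0|ne0] := eqVneq (b ^+ 2 + c ^+ 2) 0.
    have [-> ->] := K_real _ _ e0.
    by exists 1, 0; rewrite expr1n expr0n addr0 oner_eq0 !mul0r.
  by exists b, c; rewrite mulrC.
have f_inj := coord_dual_inj e_tri.
pose C k := coord_dual e k.
pose z k : dual L := nth 0 [:: C 3%N; p *: C 0%N + q *: C 1%N;
                               q *: C 0%N - p *: C 1%N; C 2%N] k.
have z1E u : z 1%N u = p * f 0%N u + q * f 1%N u.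
  by rewrite /z /= add_lfunE !scale_lfunE /C !fE.
have z2E u : z 2%N u = q * f 0%N u - p * f 1%N u.
  by rewrite /z /= add_lfunE opp_lfunE !scale_lfunE /C !fE.
have z0E u : z 0%N u = f 3%N u by rewrite /z /= /C fE.
have z3E u : z 3%N u = f 2%N u by rewrite /z /= /C fE.
apply: (@trivial_extension_symplectic _ _ s s.+4./2 4%N z).
- exact: size_basis e_tri.1.
- by lia.
- move=> u u0; apply: f_inj.
  have := u0 0%N isT; have := u0 1%N isT; have := u0 2%N isT; have := u0 3%N isT.
  rewrite z0E z1E z2E z3E => u2 e2 e1 u3.
  move=> -[|[|[|[|//]]]] _; rewrite fE //; apply: (mulfI pq_neq0); rewrite mulr0.
  + transitivity (p * (p * f 0%N u + q * f 1%N u) + q * (q * f 0%N u - p * f 1%N u)).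
      by ring.
    by rewrite e1 e2 !mulr0 addr0.
  + transitivity (q * (p * f 0%N u + q * f 1%N u) - p * (q * f 0%N u - p * f 1%N u)).
      by ring.
    by rewrite e1 e2 !mulr0 subr0.
- move=> x y w; rewrite /std_form /index_iota /= !big_cons !big_nil.
  rewrite !z0E !z1E !z2E !z3E !f3_br !f2_br !f_br //.
  transitivity ((c * p - b * q) * (f 0%N x * (f 1%N y * f 2%N w - f 2%N y * f 1%N w)
    - f 1%N x * (f 0%N y * f 2%N w - f 2%N y * f 0%N w)
    + f 2%N x * (f 0%N y * f 1%N w - f 1%N y * f 0%N w))); first by ring.
  by rewrite pq subrr mul0r.
by [].
Qed.

End LowDimension.

(** * Root space decompositions *)

Section EigenvectorSums.
Variables (K : fieldType) (V : vectType K).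

Definition sum_of (P : V -> Prop) (w : V) : Prop :=
  exists s : seq V, {in s, forall u, P u} /\ w = \sum_(u <- s) u.

Lemma sum_of0 P : sum_of P 0.
Proof. by exists [::]; rewrite big_nil. Qed.

Lemma sum_ofD P u v : sum_of P u -> sum_of P v -> sum_of P (u + v).
Proof.
move=> [s [Ps ->]] [r [Pr ->]]; exists (s ++ r); rewrite big_cat; split=> // w.
by rewrite mem_cat => /orP[/Ps|/Pr].
Qed.

Lemma sum_of_self (P : V -> Prop) u : P u -> sum_of P u.
Proof.
by exists [:: u]; rewrite big_seq1; split=> // v; rewrite inE => /eqP ->.
Qed.

Lemma sum_of_sum (P : V -> Prop) (I : eqType) (r : seq I) (F : I -> V) :
  {in r, forall i, sum_of P (F i)} -> sum_of P (\sum_(i <- r) F i).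
Proof.
elim: r => [|i r IHr] Pr; first by rewrite big_nil; apply: sum_of0.
rewrite big_cons; apply: sum_ofD; first by apply: Pr; rewrite mem_head.
by apply: IHr => j jr; apply: Pr; rewrite inE jr orbT.
Qed.

Lemma sum_of_trans (P Q : V -> Prop) w :
  (forall u, P u -> sum_of Q u) -> sum_of P w -> sum_of Q w.
Proof. by move=> PQ [s [Ps ->]]; apply: sum_of_sum => u /Ps/PQ. Qed.

Section Split.
Variables (f : {linear V -> V}) (b : seq V).
Hypothesis b_span : <<b>>%VS = fullv.
Hypothesis b_eigen : {in b, forall y, exists l, f y = l *: y}.

Variable W : V -> Prop.
Hypothesis W_lin : forall a u v, W u -> W v -> W (a *: u + v).
Hypothesis W_stable : forall u, W u -> W (f u).

(** The operator product of the f - l over l in ls. *)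
Let kill ls := foldr (fun l phi v => phi (f v - l *: v)) id ls.

Let kill_linear ls : linear (kill ls).
Proof.
elim: ls => [|l ls IHls] a u v //=.
by rewrite -IHls linearP; congr kill; rewrite !scalerDr opprD !scalerN !scalerA
  [a * l]mulrC addrACA.
Qed.

Lemma exists_kill : exists ls, uniq ls /\ forall v, kill ls v = 0.
Proof.
have [l lE] : exists l : V -> K, {in b, forall y, f y = l y *: y}.
  have /choice[l lE] : forall y, exists l, y \in b -> f y = l *: y.
    move=> y; have [/b_eigen[l lE]|_] := boolP (y \in b); last by exists 0.
    by exists l.
  by exists l => y yb; rewrite lE.
pose ls := undup (map l b); exists ls; split; first exact: undup_uniq.
pose kM := GRing.isLinear.Build _ _ _ _ (kill ls) (kill_linear ls).
pose kL : {linear V -> V} := HB.pack (kill ls) kM.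
suff /subvP k0 : (fullv <= lker (linfun kL))%VS.
  by move=> v; have := k0 v (memvf v); rewrite memv_ker lfunE => /eqP.
rewrite -b_span; apply/span_subvP => y yb; rewrite memv_ker lfunE /=; apply/eqP.
have : l y \in ls by rewrite mem_undup map_f.
have k0 ls' : kill ls' 0 = 0.
  by elim: ls' => //= m ls' IH; rewrite linear0 scaler0 subr0.
suff gen ls' (e : K) : l y \in ls' -> kill ls' (e *: y) = 0.
  by rewrite -[y in kill _ y]scale1r => /gen.
elim: ls' e => //= m ls' IHls e; rewrite inE linearZ /= lE //.
case: eqVneq => [->|_] /=; first by rewrite !scalerA mulrC subrr k0.
by rewrite !scalerA -scalerBl => /IHls.
Qed.

(** Induction on the list of eigenvalues: f w - l w splits into eigenvectors of eigenvalues m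
    different from l. Dividing each by m - l gives w' in W with (f - l) w' = (f - l) w, so that w -
    w' is an eigenvector for l. *)
Lemma eigen_split w : W w -> sum_of (fun u => W u /\ exists l, f u = l *: u) w.
Proof.
have [ls [uls kill0]] := exists_kill.
have W0 : W w -> W 0 by move=> Ww; have := W_lin (-1) Ww Ww; rewrite scaleN1r addNr.
move=> Ww; move: (kill0 w) => {kill0}.
suff gen : kill ls w = 0 ->
    sum_of (fun u => W u /\ exists2 l, l \in ls & f u = l *: u) w.
  move/gen; apply: sum_of_trans => u [Wu [l _ lE]]; apply: sum_of_self.
  by split=> //; exists l.
elim: ls uls w Ww W0 => [_ w _ _ /= ->|l ls IHls]; first exact: sum_of0.
move=> /= /andP[l_ls uls] w Ww /(_ Ww) W0 kw.
have Wf : W (f w - l *: w) by rewrite addrC -scaleNr; apply/W_lin/W_stable.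
have [s [Ps sE]] := IHls uls _ Wf (fun=> W0) kw.
have /choice[m mE] : forall u, exists m, u \in s -> m \in ls /\ f u = m *: u.
  move=> u; have [us|_] := boolP (u \in s); last by exists 0.
  by have [_ [m m_ls mE]] := Ps u us; exists m.
pose w' := \sum_(u <- s) (m u - l)^-1 *: u.
have fw' : f w' - l *: w' = f w - l *: w.
  rewrite sE linear_sum scaler_sumr -sumrB [LHS]big_seq [RHS]big_seq.
  apply: eq_bigr => u us /=; have [m_ls fu] := mE u us.
  have ml : m u - l != 0 by rewrite subr_eq0; apply: contraNneq l_ls => <-.
  by rewrite linearZ /= fu !scalerA -scalerBl [l * _]mulrC -mulrBr mulVf ?scale1r.
have Ww' : W w'.
  rewrite /w' big_seq; apply: (big_ind W) => // [x y Wx Wy|u us].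
    by rewrite -[x]scale1r; apply: W_lin.
  by rewrite -[_ *: u]addr0; apply: W_lin => //; have [] := Ps u us.
rewrite -(subrK w' w); apply: sum_ofD.
  apply: sum_of_self; split.
    by rewrite addrC -scaleN1r; apply: W_lin.
  exists l; rewrite ?mem_head // linearB scalerBr.
  have -> : f w = f w' - l *: w' + l *: w by rewrite fw' subrK.
  by apply/eqP; rewrite subr_eq -addrA addrC [- _ + _]addrC.
apply: sum_of_sum => u us; have [m_ls fu] := mE u us; apply: sum_of_self.
have [Wu _] := Ps u us; split; first by rewrite -[_ *: u]addr0; apply: W_lin.
exists (m u); first by rewrite inE m_ls orbT.
by rewrite linearZ /= fu !scalerA mulrC.
Qed.

End Split.
End EigenvectorSums.

Section Weights.
Variables (K : fieldType) (g : lieAlg K) (h : {vspace g}).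
Notation W := (dual (subvs_of h)).
Notation rs := (@in_root_space _ g h).

Lemma root_space_lin (a : W) e x y : rs a x -> rs a y -> rs a (e *: x + y).
Proof.
move=> ax ay t; rewrite lie_brDr lie_brZr ax ay scalerDr !scalerA.
by rewrite [e * _]mulrC.
Qed.

Lemma root_space0 (a : W) : rs a 0.
Proof. by move=> t; rewrite lie_br0r scaler0. Qed.

Lemma root_spaceZ (a : W) e x : rs a x -> rs a (e *: x).
Proof. by move=> ax; rewrite -[_ *: x]addr0; apply/root_space_lin/root_space0. Qed.

Lemma root_space_br (a b : W) x y : rs a x -> rs b y -> rs (a + b) [lie x, y].
Proof.
move=> ax bx t; rewrite lie_leibniz ax bx lie_brZl lie_brZr -scalerDl.
by rewrite add_lfunE.
Qed.

Lemma root_space_iter (a b : W) x y k :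
  rs a x -> rs b y -> rs (b + a *+ k) (iter k (lie_br x) y).
Proof.
move=> ax bx; elim: k => [|k IHk] /=; first by rewrite mulr0n addr0.
by rewrite mulrS addrCA; apply: root_space_br.
Qed.

Lemma exists_functional (V : vectType K) (u : V) : u != 0 ->
  exists phi : 'Hom(V, K^o), phi u = 1.
Proof.
move=> u0.
have [i ui] : exists i, coord (vbasis {:V}) i u != 0.
  apply: contrapT => /forallNP u_0; case/eqP: u0.
  rewrite (coord_vbasis (memvf u)) big1 // => i _.
  by have /negP := u_0 i; rewrite negbK => /eqP ->; rewrite scale0r.
exists ((coord (vbasis {:V}) i u)^-1 *: linfun (coord (vbasis {:V}) i : V -> K^o)).
by rewrite scale_lfunE lfunE /= /GRing.scale /= mulVf.
Qed.

(** A functional phi with phi(u) = 1 reads the eigenvalue off as phi([t, u]), which is linear in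
    t. *)
Lemma weight_of_eigen u :
    (forall t, t \in (vbasis h : seq g) -> exists l, [lie t, u] = l *: u) ->
  exists a : W, rs a u.
Proof.
have [->|u0] := eqVneq u 0; first by exists 0; apply: root_space0.
move=> u_eig; have [phi phi1] := exists_functional u0.
pose m (t : subvs_of h) : K^o := phi [lie vsval t, u].
have m_lin : linear m.
  by move=> a x y; rewrite /m linearP /= lie_br_linearl linearP.
pose mM := GRing.isLinear.Build _ _ _ _ m m_lin.
pose mL : {linear subvs_of h -> K^o} := HB.pack m mM.
exists (linfun mL) => t; rewrite lfunE /= /m.
have [l ->] : exists l, [lie vsval t, u] = l *: u.
  apply/vlineP; rewrite (coord_vbasis (subvsP t)) lie_br_suml.
  apply: memv_suml => i _; rewrite lie_brZl memvZ //; apply/vlineP.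
  by apply: u_eig; apply: mem_nth; rewrite size_tuple.
by rewrite linearZ /= phi1 /GRing.scale /= mulr1.
Qed.

Hypothesis h_cartan : cartan_subalgebra h.

(** A basis of h is diagonalized one element at a time: h being abelian, each joint eigenspace of
    the elements already treated is stable under the next one. *)
Lemma weight_decomposition w : sum_of (fun u => exists a : W, rs a u) w.
Proof.
have [h_ab _ h_diag] := h_cartan.
suff gen (T : seq g) : {subset T <= h} -> forall w,
    sum_of (fun u => forall t, t \in T -> exists l, [lie t, u] = l *: u) w.
  have hb : {subset (vbasis h : seq g) <= h} by move=> t; apply: vbasis_mem.
  apply: sum_of_trans (gen _ hb w) => u u_eig; apply: sum_of_self.
  exact: weight_of_eigen.
elim: T => [|t T IHT] Th w'; first by apply: sum_of_self.
have th : t \in h by apply: Th; rewrite mem_head.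
have {}Th : {subset T <= h} by move=> y yT; apply: Th; rewrite inE yT orbT.
apply: sum_of_trans (IHT Th w') => u u_eig.
have [b b_span b_eig] := h_diag t th.
have /choice[l lE] : forall t', exists l, t' \in T -> [lie t', u] = l *: u.
  move=> t'; have [/u_eig[l lE]|_] := boolP (t' \in T); last by exists 0.
  by exists l.
apply: (sum_of_trans _ (eigen_split (f := lie_br t) b_span b_eig
  (W := fun v => forall t', t' \in T -> [lie t', v] = l t' *: v) _ _ lE)).
- move=> v [v_T v_t]; apply: sum_of_self => t'; rewrite inE => /orP[/eqP->//|t'T].
  by exists (l t'); apply: v_T.
- move=> a x y xT yT t' t'T; rewrite lie_brDr lie_brZr xT // yT // scalerDr.
  by rewrite !scalerA mulrC.
move=> v vT t' t'T; rewrite lie_leibniz (h_ab _ _ (Th _ t'T) th) lie_br0l add0r.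
by rewrite vT // lie_brZr.
Qed.

(** Adjoining x to h leaves it abelian, so maximality of h applies. *)
Lemma centralizer_cartan x : rs 0 x -> x \in h.
Proof.
have [h_ab h_max _] := h_cartan => x0.
have x_comm t : t \in h -> [lie t, x] = 0.
  by move=> th; have := x0 (vsproj h t); rewrite vsprojK // zero_lfunE scale0r.
have <- : (h + <[x]>)%VS = h; last first.
  by rewrite (subvP (addvSr _ _)) // memv_line.
apply: h_max; first exact: addvSl.
move=> _ _ /memv_addP[u uh [_ /vlineP[a ->] ->]] /memv_addP[v vh [_ /vlineP[b ->] ->]].
rewrite lie_brDl !lie_brDr !lie_brZl !lie_brZr lie_brxx (h_ab u v) //.
by rewrite (lie_brC x v) !x_comm // oppr0 !scaler0 !addr0.
Qed.

End Weights.

(** * Invariant forms and the duality of opposite weights *)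

Section InvariantForm.
Variables (K : fieldType) (g : lieAlg K).

Record invariant_form (B : g -> g -> K) : Prop := InvariantForm {
  inv_linearl : forall a x y z, B (a *: x + y) z = a * B x z + B y z;
  inv_sym : forall x y, B x y = B y x;
  inv_br : forall x y z, B [lie x, y] z = B x [lie y, z];
  inv_nondeg : forall x, (forall y, B x y = 0) -> x = 0
}.

Variable B : g -> g -> K.
Hypothesis B_inv : invariant_form B.

Lemma invDl x y z : B (x + y) z = B x z + B y z.
Proof. by have := inv_linearl B_inv 1 x y z; rewrite scale1r mul1r. Qed.
Lemma inv0l z : B 0 z = 0.
Proof. by apply: (addrI (B 0 z)); rewrite -invDl !addr0. Qed.
Lemma invZl a x z : B (a *: x) z = a * B x z.
Proof. by rewrite -[a *: x]addr0 (inv_linearl B_inv) inv0l addr0. Qed.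
Lemma invDr x y z : B z (x + y) = B z x + B z y.
Proof. by rewrite !(inv_sym B_inv z) invDl. Qed.
Lemma inv0r z : B z 0 = 0.
Proof. by rewrite (inv_sym B_inv) inv0l. Qed.
Lemma invZr a x z : B z (a *: x) = a * B z x.
Proof. by rewrite !(inv_sym B_inv z) invZl. Qed.
Lemma inv_suml (I : Type) (r : seq I) (P : pred I) (F : I -> g) z :
  B (\sum_(i <- r | P i) F i) z = \sum_(i <- r | P i) B (F i) z.
Proof. exact: (big_morph (B ^~ z) (fun x y => invDl x y z) (inv0l z)). Qed.
Lemma inv_sumr (I : Type) (r : seq I) (P : pred I) (F : I -> g) z :
  B z (\sum_(i <- r | P i) F i) = \sum_(i <- r | P i) B z (F i).
Proof. exact: (big_morph (B z) (fun x y => invDr x y z) (inv0r z)). Qed.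
Lemma inv_brC x y z : B [lie x, y] z = - B y [lie x, z].
Proof.
by rewrite lie_brC -scaleN1r invZl mulN1r (inv_br B_inv).
Qed.

Variable h : {vspace g}.
Hypothesis h_cartan : cartan_subalgebra h.
Notation W := (dual (subvs_of h)).
Notation rs := (@in_root_space _ g h).

(** Invariance gives (a + b)(t) B(x, y) = 0 for all t in h. *)
Lemma root_space_orthogonal (a b : W) x y :
  rs a x -> rs b y -> a + b != 0 -> B x y = 0.
Proof.
move=> ax bY ab; apply/eqP; apply: contraNT ab => Bxy; apply/eqP/lfunP=> t.
rewrite add_lfunE zero_lfunE; apply/eqP; rewrite addr_eq0.
apply/eqP/(mulIf Bxy).
by rewrite -invZl -ax inv_brC bY invZr mulNr.
Qed.

(* A nonzero weight vector is paired nontrivially with some vector of the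
   opposite weight, since those of the other weights are orthogonal to it. *)
Lemma root_space_pairing (a : W) x : x != 0 -> rs a x ->
  exists y, rs (- a) y /\ B x y = 1.
Proof.
move=> x0 ax; apply: contrapT => /forallNP Nxy; case/eqP: x0.
apply: (inv_nondeg B_inv) => w.
have [s [sW ->]] := weight_decomposition h_cartan w.
rewrite inv_sumr big_seq big1 // => u /sW[b bu].
have [ab|] := eqVneq (a + b) 0; last exact: root_space_orthogonal ax bu.
have be : b = - a by apply/eqP; rewrite -addr_eq0 addrC ab.
apply/eqP; apply: contrapT => /negP Bxu; apply: (Nxy ((B x u)^-1 *: u)); split.
  by apply: root_spaceZ; rewrite -be.
by rewrite invZr mulVf.
Qed.

End InvariantForm.

(** A one-dimensional algebra qualifies as well; [center_eq0] rules this case out by the presence of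
    a root. *)
Definition simple_lie (K : fieldType) (g : lieAlg K) : Prop :=
  forall I : {vspace g}, (forall x y, y \in I -> [lie x, y] \in I) ->
    I = 0%VS \/ I = fullv.

(** * Strings for an unnormalized sl(2)-triple *)

Section SL2.
Variables (K : numFieldType) (g : lieAlg K) (x y u : g) (c l : K).
Hypotheses (hy : [lie [lie x, y], y] = - c *: y) (xu : [lie x, u] = 0).
Hypothesis hu : [lie [lie x, y], u] = l *: u.

Lemma sl2_weight k :
  [lie [lie x, y], iter k (lie_br y) u] = (l - c *+ k) *: iter k (lie_br y) u.
Proof.
elim: k => [|k IHk] /=; first by rewrite mulr0n subr0.
rewrite lie_leibniz hy IHk lie_brZl lie_brZr -scalerDl mulrS opprD.
by rewrite addrCA.
Qed.

(** For c = 2 this is the usual factor (k + 1)(l - k); c stays free, and may even be 0, to serve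
    before coroots are known to be nonzero. *)
Lemma sl2_raise k : [lie x, iter k.+1 (lie_br y) u] =
  ((l *+ 2 - c *+ k) *+ k.+1 / 2%:R) *: iter k (lie_br y) u.
Proof.
elim: k => [|k IHk].
  by rewrite /= lie_leibniz xu lie_br0r addr0 hu; congr (_ *: _); field.
rewrite iterS lie_leibniz sl2_weight IHk lie_brZr -scalerDl.
congr (_ *: _); rewrite -(mulr_natr c k.+1) -(mulr_natr c k).
rewrite -(mulr_natr (_ - _) k.+1) -(mulr_natr _ k.+2) -(mulr_natr l).
rewrite -[k.+2]addn2 -[k.+1]addn1 !natrD.
by move: (k%:R : K) => n; field.
Qed.

(** Applying x to the vanishing vector at step k+1 gives a multiple of the nonzero vector at step k,
    so the factor of [sl2_raise] is 0. *)
Lemma sl2_lowest k : iter k (lie_br y) u != 0 -> iter k.+1 (lie_br y) u = 0 ->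
  l *+ 2 = c *+ k.
Proof.
move=> yk yk1; have := sl2_raise k; rewrite yk1 lie_br0r => /eqP.
rewrite eq_sym scaler_eq0 (negPf yk) orbF mulf_eq0 invr_eq0 pnatr_eq0 orbF.
by rewrite mulrn_eq0 /= subr_eq0 => /eqP.
Qed.

End SL2.

Lemma independent_dim (K : fieldType) (V : vectType K) (I : finType) (v : I -> V) :
    (forall k : I -> K, \sum_i k i *: v i = 0 -> forall i, k i = 0) ->
  (#|I| <= \dim {:V})%N.
Proof.
move=> v_indep; pose f (k : {ffun I -> K^o}) := \sum_i (k i : K) *: v i.
have f_lin : linear f.
  move=> e k l; rewrite /f scaler_sumr -big_split; apply: eq_bigr => i _ /=.
  by rewrite !ffunE scalerA -scalerDl.
pose fM := GRing.isLinear.Build _ _ _ _ f f_lin.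
pose fL : {linear {ffun I -> K^o} -> V} := HB.pack f fM.
have ker0 : lker (linfun fL) == 0%VS.
  rewrite -subv0; apply/subvP=> k; rewrite memv_ker lfunE memv0 => /eqP fk0.
  by apply/eqP/ffunP => i; rewrite (v_indep _ fk0) ffunE.
have <- : \dim {: {ffun I -> K^o}} = #|I| by rewrite dimvf /dim /= muln1.
by rewrite -(limg_dim_eq (f := linfun fL)) ?(eqP ker0) ?capv0 // dimvS ?subvf.
Qed.

(** * Roots, coroots and root strings *)

Section Roots.
Variables (K : numFieldType) (g : lieAlg K) (B : g -> g -> K).
Hypotheses (B_inv : invariant_form B) (g_simple : simple_lie g).
Variable h : {vspace g}.
Hypothesis h_cartan : cartan_subalgebra h.
Variables (d : nat) (alpha : d.-tuple (dual (subvs_of h))) (X : 'I_d -> g).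
Hypothesis alpha_uniq : uniq alpha.
Hypothesis alpha_pos : positive_system (fun a => a \in alpha).
Hypothesis X_span :
  forall i y, in_root_space (tnth alpha i) y <-> y \in <[X i]>%VS.

Notation W := (dual (subvs_of h)).
Notation rs := (@in_root_space _ g h).
Notation a := (tnth alpha).

Lemma pos_root_inj i j : a i = a j -> i = j.
Proof. by move/tuple_uniqP: alpha_uniq; apply. Qed.

Lemma pos_root_neq0 i : a i != 0.
Proof. by have [+ _ _ _] := alpha_pos => /(_ _ (mem_tnth i alpha)) [/eqP]. Qed.

Lemma pos_vec i : rs (a i) (X i).
Proof. by apply/X_span/memv_line. Qed.

Lemma pos_vec_neq0 i : X i != 0.
Proof.
have [+ _ _ _] := alpha_pos => /(_ _ (mem_tnth i alpha)) [_ [x x0 ix]].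
by apply: contra_notN x0 => /eqP X0; have /X_span := ix; rewrite X0 => /vlineP[k ->];
  rewrite scaler0.
Qed.

Lemma pos_root_sum_neq0 i j : a i + a j != 0.
Proof.
have [_ _ N _] := alpha_pos; apply/eqP => /eqP; rewrite addr_eq0 => /eqP e.
by apply: (N (a j)); rewrite -e !mem_tnth.
Qed.

Lemma pos_root_sum i j u : rs (a i + a j) u -> u != 0 -> exists k, a k = a i + a j.
Proof.
move=> iju u0; have [_ _ _ A] := alpha_pos.
have /tnthP[k ->] : a i + a j \in alpha; last by exists k.
apply: A; rewrite ?mem_tnth //; split; first exact/eqP/pos_root_sum_neq0.
by exists u => //; apply/eqP.
Qed.

Lemma weight_cases (b : W) u : rs b u -> u != 0 ->
  b = 0 \/ exists i, b = a i \/ b = - a i.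
Proof.
move=> bu u0; have [->|b0] := eqVneq b 0; [by left|right].
have [_ A _ _] := alpha_pos.
have [|/tnthP[i e]|/tnthP[i e]] := A b.
- by split; [apply/eqP|exists u => //; apply/eqP].
- by exists i; left.
by exists i; right; rewrite -e opprK.
Qed.

Lemma neg_vec_exists i : exists y, rs (- a i) y /\ B (X i) y = 1.
Proof. exact: (root_space_pairing B_inv h_cartan (pos_vec_neq0 i) (pos_vec i)). Qed.

Variable Y : 'I_d -> g.
Hypothesis Y_neg : forall i, rs (- a i) (Y i).
Hypothesis XY : forall i, B (X i) (Y i) = 1.

Lemma pos_spaceE i u : rs (a i) u -> u = B u (Y i) *: X i.
Proof. by move/X_span/vlineP => [k ->]; rewrite (invZl B_inv) XY mulr1. Qed.

(** The difference of the two sides is orthogonal to X_i. Were it nonzero, it would pair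
    nontrivially with a vector of weight a_i, that is, a multiple of X_i. *)
Lemma neg_spaceE i u : rs (- a i) u -> u = B (X i) u *: Y i.
Proof.
move=> iu; apply/eqP; rewrite -subr_eq0; apply: contraT => u'0.
have iu' : rs (- a i) (u - B (X i) u *: Y i).
  by rewrite addrC -scaleNr; apply: root_space_lin.
have [w [+ Bw]] := root_space_pairing B_inv h_cartan u'0 iu'.
rewrite opprK => /pos_spaceE we.
move: Bw; rewrite we (invZr B_inv) -scaleNr (inv_sym B_inv (u + _)) (invDr B_inv).
by rewrite (invZr B_inv) XY mulr1 subrr mulr0 => /eqP; rewrite eq_sym oner_eq0.
Qed.

Lemma neg_root_sum i j u :
  rs (- (a i + a j)) u -> u != 0 -> exists k, a k = a i + a j.
Proof.
move=> iju u0; have [w []] := root_space_pairing B_inv h_cartan u0 iju.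
rewrite opprK => ijw Buw; apply: (pos_root_sum ijw).
by apply/eqP => w0; have /eqP := Buw; rewrite w0 (inv0r B_inv) eq_sym oner_eq0.
Qed.

(* There are finitely many weights, so that weight strings are finite. *)
Lemma weight_string_end (b c : W) : c != 0 ->
  exists k, forall u, rs (b + c *+ k) u -> u = 0.
Proof.
move=> c0; apply: contrapT => /forallNP Nk.
pose Phi : seq W := 0 :: alpha ++ map -%R alpha.
have in_Phi k : b + c *+ k \in Phi.
  have /existsNP[u /not_implyP[ku /eqP u0]] := Nk k.
  rewrite /Phi inE mem_cat; have [->|[i [->|->]]] := weight_cases ku u0.
  - by rewrite eqxx.
  - by rewrite mem_tnth orbT.
  by rewrite map_f ?mem_tnth ?orbT.
have := @uniq_leq_size _ [seq b + c *+ k | k <- iota 0 (size Phi).+1] Phi.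
rewrite size_map size_iota ltnn => e; suff : false by [].
apply: e => [|w /mapP[k _ ->]]; last exact: in_Phi.
rewrite map_inj_uniq ?iota_uniq // => k l /addrI/eqP.
have ck_lt m n : (m < n)%N -> (c *+ m == c *+ n) = false.
  move=> mn; rewrite eq_sym -subr_eq0 -mulrnBr ?(ltnW mn) //.
  rewrite -scaler_nat scaler_eq0 (negPf c0) orbF pnatr_eq0.
  by rewrite subn_eq0 leqNgt mn.
by case: (ltngtP k l) => // kl; rewrite ?(ck_lt _ _ kl) // eq_sym ck_lt.
Qed.

(** As B(X_i, Y_i) = 1, this is the vector of h representing a_i under B ([inv_coroot]). It is only
    proportional to the usual coroot: a_i need not take the value 2 on it. *)
Definition coroot i : subvs_of h := vsproj h [lie X i, Y i].

Lemma corootE i : vsval (coroot i) = [lie X i, Y i].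
Proof.
rewrite vsprojK //; apply: (centralizer_cartan h_cartan).
by rewrite -(subrr (a i)); apply: root_space_br (pos_vec i) (Y_neg i).
Qed.

Lemma coroot_act i (b : W) u : rs b u ->
  [lie [lie X i, Y i], u] = (b (coroot i) : K) *: u.
Proof. by move=> bu; rewrite -corootE bu. Qed.

Lemma inv_coroot i (t : subvs_of h) : B (vsval (coroot i)) (vsval t) = a i t.
Proof.
rewrite corootE (inv_br B_inv) lie_brC -scaleN1r (invZr B_inv) (Y_neg i).
by rewrite (invZr B_inv) XY opp_lfunE mulr1 mulN1r opprK.
Qed.

Lemma iter_first_zero (f : g -> g) u : u != 0 -> (exists k, iter k f u = 0) ->
  exists k, iter k f u != 0 /\ iter k.+1 f u = 0.
Proof.
move=> u0 [k]; elim: k => [u0'|k IHk]; first by rewrite [u]u0' eqxx in u0.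
by have [/IHk|k0 k1] := eqVneq (iter k f u) 0; [|exists k].
Qed.

Lemma pos_string_end i (b : W) u : rs b u -> exists k, iter k (lie_br (X i)) u = 0.
Proof.
move=> bu; have [k k0] := weight_string_end b (pos_root_neq0 i).
by exists k; apply: k0; apply: root_space_iter (pos_vec i) bu.
Qed.

Lemma neg_string_end i (b : W) u : rs b u -> exists k, iter k (lie_br (Y i)) u = 0.
Proof.
move=> bu; have Ni : - a i != 0 by rewrite oppr_eq0 pos_root_neq0.
have [k k0] := weight_string_end b Ni.
by exists k; apply: k0; apply: root_space_iter (Y_neg i) bu.
Qed.

Notation cart i b := ((b : dual (subvs_of h)) (coroot i) : K).

Lemma lowest_weight i (b : W) u k : rs b u -> [lie X i, u] = 0 ->
    iter k (lie_br (Y i)) u != 0 -> iter k.+1 (lie_br (Y i)) u = 0 ->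
  cart i b *+ 2 = cart i (a i) *+ k.
Proof.
move=> bu Xu; apply: (sl2_lowest (x := X i)) => //; last exact: coroot_act.
by rewrite (coroot_act i (Y_neg i)) opp_lfunE.
Qed.

(** Integrality and dominance of highest weights, cleared of the denominator a_i(H_i). No root
    reflection is involved: only finiteness of the Y_i-string. *)
Lemma highest_weight i (b : W) u : rs b u -> u != 0 -> [lie X i, u] = 0 ->
  exists k, cart i b *+ 2 = cart i (a i) *+ k.
Proof.
move=> bu u0 Xu.
have [k [k0 k1]] := iter_first_zero u0 (neg_string_end i bu).
by exists k; apply: lowest_weight k1.
Qed.

(** The line of z is an ideal. If it were all of g, the root vector X_i would be central, and a_i
    would be 0. *)
Lemma center_eq0 (z : g) : (0 < d)%N -> (forall x, [lie x, z] = 0) -> z = 0.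
Proof.
move=> d_gt0 zc.
have [|/eqP|zg] := g_simple (I := <[z]>%VS).
- by move=> x y /vlineP[k ->]; rewrite lie_brZr zc scaler0 mem0v.
- by rewrite -subv0 -memvE memv0 => /eqP.
pose i := Ordinal d_gt0; case/eqP: (pos_root_neq0 i); apply/lfunP => t.
have /vlineP[k Xk] : X i \in <[z]>%VS by rewrite zg memvf.
have /eqP := pos_vec i t; rewrite Xk lie_brZr zc scaler0 -Xk eq_sym scaler_eq0.
by rewrite (negPf (pos_vec_neq0 i)) orbF zero_lfunE => /eqP.
Qed.

Lemma weight_vectors_span (f : {linear g -> g}) :
  (forall (b : W) u, rs b u -> f u = 0) -> forall u, f u = 0.
Proof.
move=> f0 u; have [s [sW ->]] := weight_decomposition h_cartan u.
rewrite linear_sum big_seq big1 // => w /sW[b]; exact: f0.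
Qed.

(* If a_i vanished on its coroot H_i, every weight would vanish on H_i by the
   representation theory of the Heisenberg algebra spanned by X_i, Y_i, H_i,
   and H_i would be central. *)
Lemma coroot_neq0 i : cart i (a i) != 0.
Proof.
apply/eqP => ai0.
have cart0 (b : W) u : rs b u -> u != 0 -> cart i b = 0.
  (* The top of the X_i-string through u has weight b + k a_i, which agrees with b on H_i. *)
  move=> bu u0; have [k [k0 k1]] := iter_first_zero u0 (pos_string_end i bu).
  have [m] := highest_weight (root_space_iter k (pos_vec i) bu) k0 k1.
  rewrite ai0 mul0rn add_lfunE -scaler_nat scale_lfunE ai0 scaler0 addr0 => /eqP.
  by rewrite mulrn_eq0 => /eqP.
have H0 : [lie X i, Y i] = 0.
  apply: center_eq0 => [|u]; first exact: leq_ltn_trans (leq0n i) (ltn_ord i).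
  rewrite lie_brC; apply/eqP; rewrite oppr_eq0; apply/eqP.
  apply: (weight_vectors_span (f := lie_br [lie X i, Y i])) => b w bw.
  rewrite /= (coroot_act i bw); have [->|w0] := eqVneq w 0; first by rewrite scaler0.
  by rewrite (cart0 b w) // scale0r.
case/eqP: (pos_root_neq0 i); apply/lfunP => t.
by rewrite -inv_coroot corootE H0 (inv0l B_inv) zero_lfunE.
Qed.

(* If sum_(j in s) a_j = 0 and i is in s, pairing with the coroot of a_i shows
   that [X_i, X_j] <> 0 for another j in s, so that a_i and a_j can be replaced
   with their sum. *)
Lemma pos_root_sums_neq0 (s : seq 'I_d) : s != [::] -> \sum_(i <- s) a i != 0.
Proof.
have [n] := ubnP (size s); elim: n s => // n IHn [|i s] //= s_le _.
have [/hasP[j js /existsP[k /eqP ek]]|Nsum] :=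
    boolP (has (fun j => [exists k, a k == a i + a j]) s).
  have -> : \sum_(l <- i :: s) a l = \sum_(l <- k :: rem j s) a l.
    by rewrite !big_cons (big_rem j) //= addrA ek.
  by apply: IHn => //=; rewrite size_rem //; case: (s) js s_le.
have ge0 j : j \in s -> exists k, cart i (a j) *+ 2 = cart i (a i) *+ k.
  move=> js; apply: (highest_weight (pos_vec j) (pos_vec_neq0 j)).
  apply/eqP; apply: contraNT Nsum => Xij; apply/hasP; exists j => //.
  apply/existsP; have [k ek] := pos_root_sum (root_space_br (pos_vec i) (pos_vec j)) Xij.
  by exists k; apply/eqP.
have [m sE] : exists m, cart i (\sum_(j <- s) a j) *+ 2 = cart i (a i) *+ m.
  elim: (s) ge0 => [|j r IHr] ge0; first by exists 0%N; rewrite big_nil zero_lfunE mul0rn.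
  have [k ek] := ge0 j (mem_head _ _).
  have [|m em] := IHr; first by move=> l lr; apply: ge0; rewrite inE lr orbT.
  by exists (k + m)%N; rewrite big_cons add_lfunE mulrnDl ek em mulrnDr.
rewrite big_cons; apply/eqP => /lfunP/(_ (coroot i)).
rewrite add_lfunE zero_lfunE => /(congr1 (fun x : K => x *+ 2)).
rewrite mulrnDl sE -mulrnDr mul0rn => /eqP; rewrite mulrn_eq0 => /orP[//|].
by rewrite (negPf (coroot_neq0 i)).
Qed.

Definition below i j : Prop :=
  exists s, s != [::] /\ a j = a i + \sum_(l <- s) a l.

(** A substitute for the height relative to simple roots: all that is used is its growth when a
    positive root is added. *)
Definition height j : nat := #|[set i | `[< below i j >]]|.

(** Whatever lies below i lies below k, and i itself is new: it is not below itself, since nonempty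
    sums of positive roots are nonzero. *)
Lemma height_lt i j k : a k = a i + a j -> (height i < height k)%N.
Proof.
move=> e; apply: proper_card; apply/properP; split.
  apply/subsetP=> l; rewrite !inE => /asboolP[s [_ es]]; apply/asboolP.
  by exists (rcons s j); rewrite e es -cats1 big_cat big_seq1 addrA; case: (s).
exists i; rewrite inE; first by apply/asboolP; exists [:: j]; rewrite big_seq1.
apply/asboolP => -[s [s0 /eqP]]; rewrite -subr_eq0 opprD addrA subrr sub0r.
by rewrite oppr_eq0; apply/negP; apply: pos_root_sums_neq0.
Qed.

Lemma cartD i (b b' : W) : cart i (b + b') = cart i b + cart i b'.
Proof. by rewrite add_lfunE. Qed.
Lemma cartN i (b : W) : cart i (- b) = - cart i b.
Proof. by rewrite opp_lfunE. Qed.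

(** * The grading by the coroot of a central root vector *)

Section CentralRootVector.
Variable t : 'I_d.
Hypothesis Xt_central : forall i, [lie X t, X i] = 0.
Notation c := (cart t (a t)).

Lemma mulrn_coroot_eq0 k : c *+ k = 0 -> k = 0%N.
Proof. by move/eqP; rewrite mulrn_eq0 (negPf (coroot_neq0 t)) orbF => /eqP. Qed.

(** Vanishing of [X_t, X_j] does not by itself prevent a_t + a_j from being a root. If it were a_i,
    then [Y_t, X_i] would be a multiple of X_j, killed by X_t, so a_i(H_t) = 0 and a_j(H_t) = -c.
    But X_j is a highest weight vector, so 2 a_j(H_t) is a natural multiple of c, which is
    nonzero. *)
Lemma root_sum_central i j : a i <> a t + a j.
Proof.
move=> e.
have Yv : rs (a j) [lie Y t, X i].
  by have := root_space_br (Y_neg t) (pos_vec i); rewrite e addrA addNr add0r.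
have ci0 : cart t (a i) = 0.
  have : [lie X t, [lie Y t, X i]] = 0.
    by rewrite (pos_spaceE Yv) lie_brZr Xt_central scaler0.
  rewrite lie_leibniz Xt_central lie_br0r addr0 (coroot_act t (pos_vec i)) => /eqP.
  by rewrite scaler_eq0 (negPf (pos_vec_neq0 i)) orbF => /eqP.
have [k] := highest_weight (pos_vec j) (pos_vec_neq0 j) (Xt_central j).
move: ci0; rewrite e cartD addrC => /eqP; rewrite addr_eq0 => /eqP ->.
rewrite mulNrn => /eqP; rewrite eq_sym -subr_eq0 opprK -mulrnDr => /eqP.
by move/mulrn_coroot_eq0; rewrite addnC.
Qed.

Lemma neg_bracket_central k : [lie Y t, Y k] = 0.
Proof.
apply/eqP; apply: contraT => Ytk.
have := root_space_br (Y_neg t) (Y_neg k); rewrite -opprD => ntk.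
by have [l /root_sum_central] := neg_root_sum ntk Ytk.
Qed.

(** The Y_t-string from the highest weight vector X_i has at most two members: if [Y_t, X_i] is
    nonzero, its weight is some -a_k, and Y_t commutes with Y_k. Strings of one and two members give
    degrees 0 and 1. *)
Lemma cart_central i : i != t ->
  cart t (a i) = 0 /\ [lie Y t, X i] = 0
  \/ [/\ cart t (a i) *+ 2 = c, [lie Y t, X i] != 0 & exists k, a i + a k = a t].
Proof.
move=> it; have [Yi|Yi] := eqVneq [lie Y t, X i] 0.
  left; split=> //; have := lowest_weight (k := 0) (pos_vec i) (Xt_central i).
  rewrite mulr0n => /(_ (pos_vec_neq0 i) Yi)/eqP.
  by rewrite mulrn_eq0 => /eqP.
right; have Yv := root_space_br (Y_neg t) (pos_vec i).
have [e|[k [e|e]]] := weight_cases Yv Yi.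
- by case/eqP: it; apply: pos_root_inj; apply/eqP; rewrite -subr_eq0 addrC e.
- by case: (@root_sum_central i k); rewrite -e addrA addrN add0r.
rewrite e in Yv; split=> //; last first.
  by exists k; rewrite -[a k]opprK -e opprD opprK addrCA addrN addr0.
apply: (@lowest_weight t _ _ 1 (pos_vec i) (Xt_central i) Yi).
by rewrite /= (neg_spaceE Yv) lie_brZr neg_bracket_central scaler0.
Qed.

Definition half_set : {set 'I_d} := [set i | cart t (a i) *+ 2 == c].
(** The partner of i in the Heisenberg pairing, with root a_t - a_i; the default i is never reached
    on [half_set]. *)
Definition half_dual i := odflt i [pick k | a i + a k == a t].

Lemma t_notin_half : t \notin half_set.
Proof.
rewrite inE mulr2n -subr_eq0 addrK; exact: coroot_neq0.
Qed.

Lemma half_neq i : i \in half_set -> i != t.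
Proof. by apply: contraTneq => ->; apply: t_notin_half. Qed.

Lemma half_cart i : i \in half_set -> cart t (a i) *+ 2 = c.
Proof. by rewrite inE => /eqP. Qed.

Lemma half_dual_sum i : i \in half_set -> a i + a (half_dual i) = a t.
Proof.
move=> iS; rewrite /half_dual; case: pickP => [k /eqP //|Nk].
have [[ci0 _]|[_ _ [k e]]] := cart_central (half_neq iS).
  have := half_cart iS; rewrite ci0 mul0rn => /esym/eqP.
  by rewrite (negPf (coroot_neq0 t)).
by have := Nk k; rewrite e eqxx.
Qed.

Lemma half_dual_in i : i \in half_set -> half_dual i \in half_set.
Proof.
move=> iS; have := congr1 (fun b : W => cart t b *+ 2) (half_dual_sum iS).
rewrite /= cartD mulrnDl (half_cart iS) [c *+ 2]mulr2n => /addrI e.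
by rewrite inE e.
Qed.

Lemma half_dualK i : i \in half_set -> half_dual (half_dual i) = i.
Proof.
move=> iS; apply: pos_root_inj; apply: (addrI (a (half_dual i))).
by rewrite half_dual_sum ?half_dual_in // addrC half_dual_sum.
Qed.

(** The sum has degree 2, whereas positive roots other than a_t have degree 0 or 1. *)
Lemma half_sum i j k : i \in half_set -> j \in half_set -> a k = a i + a j -> k = t.
Proof.
move=> iS jS e; apply/eqP; apply: contraT => kt.
have ck : cart t (a k) *+ 2 = c *+ 2.
  by rewrite e cartD mulrnDl (half_cart iS) (half_cart jS) mulr2n.
have c0 := coroot_neq0 t.
have [[ck0 _]|[ck1 _ _]] := cart_central kt.
  by move/eqP: ck; rewrite ck0 mul0rn eq_sym mulrn_eq0 (negPf c0).
move/eqP: ck; rewrite ck1 mulr2n -subr_eq0 opprD addrA subrr sub0r oppr_eq0.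
by rewrite (negPf c0).
Qed.

Lemma cart0_notin_half i : i != t -> i \notin half_set -> cart t (a i) = 0.
Proof.
move=> it iS; have [[]//|[e _ _]] := cart_central it.
by move: iS; rewrite inE e eqxx.
Qed.

Lemma half_translate i j k : i != t -> i \notin half_set -> j \in half_set ->
  a k = a i + a j -> k \in half_set.
Proof.
by move=> it iS jS e; rewrite inE e cartD cart0_notin_half // add0r half_cart.
Qed.

(** By invariance, pairing the bracket with Y_t amounts up to sign to pairing X of the partner with
    [Y_t, X_i], a nonzero vector of the opposite weight. *)
Lemma half_dual_br i : i \in half_set -> [lie X i, X (half_dual i)] != 0.
Proof.
move=> iS; have c0 := coroot_neq0 t.
have Yi : [lie Y t, X i] != 0.
  have [[ci0 _]|[]//] := cart_central (half_neq iS).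
  by have /esym/eqP := half_cart iS; rewrite ci0 mul0rn (negPf c0).
have Yv : rs (- a (half_dual i)) [lie Y t, X i].
  have := root_space_br (Y_neg t) (pos_vec i).
  by rewrite -(half_dual_sum iS) opprD addrAC addNr add0r.
have : B [lie X (half_dual i), X i] (Y t) != 0.
  rewrite (inv_br B_inv) lie_brC -scaleN1r (invZr B_inv) mulN1r oppr_eq0.
  by apply: contraNneq Yi => B0; rewrite (neg_spaceE Yv) B0 scale0r.
by apply: contraNneq => Xi; rewrite lie_brC Xi oppr0 (inv0l B_inv).
Qed.

Fixpoint centralizer (T : seq g) : {vspace g} :=
  if T is w :: T' then (lker (linfun (lie_br w)) :&: centralizer T')%VS else fullv.

Lemma centralizerP (T : seq g) x :
  reflect {in T, forall w, [lie w, x] = 0} (x \in centralizer T).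
Proof.
elim: T => [|w T IHT] /=; first by rewrite memvf; apply: ReflectT.
rewrite memv_cap memv_ker lfunE /=.
apply: (iffP andP) => [[/eqP wx /IHT Tx] u|Tx].
  by rewrite inE => /orP[/eqP->|/Tx].
split; first by rewrite Tx ?mem_head.
by apply/IHT => u uT; rewrite Tx // inE uT orbT.
Qed.

Let T := t |: half_set.
Let XYT := [seq X i | i <- enum T] ++ [seq Y i | i <- enum T].

Lemma commutes_XY x : (forall i, i \in T -> [lie X i, x] = 0 /\ [lie Y i, x] = 0) ->
  x \in centralizer XYT.
Proof.
move=> xT; apply/centralizerP => w; rewrite mem_cat => /orP[] wT.
  have [i + ->] := elimT (@mapP _ _ X (enum T) w) wT.
  by rewrite mem_enum => /xT[].
have [i + ->] := elimT (@mapP _ _ Y (enum T) w) wT.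
by rewrite mem_enum => /xT[].
Qed.

Lemma in_T i : (i \in T) = (cart t (a i) != 0).
Proof.
rewrite inE in_set1; have [->|it] /= := eqVneq i t; first by rewrite coroot_neq0.
have [iS|iS] := boolP (i \in half_set); last by rewrite cart0_notin_half ?eqxx.
apply/esym; apply: contraTneq iS => ci0.
by rewrite inE ci0 mul0rn eq_sym coroot_neq0.
Qed.

Lemma nonzero_cart (b : W) u : rs b u -> u != 0 -> cart t b != 0 ->
  exists2 i, i \in T & (b = a i /\ exists m, u = m *: X i) \/
                       (b = - a i /\ exists m, u = m *: Y i).
Proof.
move=> bu u0 ctb.
have [b0|[i [e|e]]] := weight_cases bu u0.
- by rewrite b0 zero_lfunE eqxx in ctb.
- exists i; first by rewrite in_T -e.
  by left; split=> //; rewrite e in bu; rewrite (pos_spaceE bu); eexists.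
exists i; first by rewrite in_T -oppr_eq0 -cartN -e.
by right; split=> //; rewrite e in bu; rewrite (neg_spaceE bu); eexists.
Qed.

(* The centralizer of the root vectors of nonzero degree, for the grading by
   the eigenvalues of the coroot of a_t, is an ideal. *)
Lemma centralizer_eq0 x : x \in centralizer XYT -> x = 0.
Proof.
have tT : t \in T by rewrite setU11.
have XYx (z : g) i : z \in centralizer XYT -> i \in T ->
    [lie X i, z] = 0 /\ [lie Y i, z] = 0.
  by move=> /centralizerP zc iT; split; apply: zc; rewrite mem_cat map_f ?mem_enum // orbT.
have cent_deg (b : W) u z : rs b u -> z \in centralizer XYT -> cart t b != 0 ->
    [lie u, z] = 0.
  move=> bu zc ctb; have [->|u0] := eqVneq u 0; first by rewrite lie_br0l.
  by have [i iT [[_ [m ->]]|[_ [m ->]]]] := nonzero_cart bu u0 ctb;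
    have [Xz Yz] := XYx z i zc iT; rewrite lie_brZl ?Xz ?Yz scaler0.
case: (g_simple (I := centralizer XYT)) => [y z zc|->|cf].
- have [s [sW ->]] := weight_decomposition h_cartan y.
  rewrite lie_br_suml big_seq memv_suml // => u /sW[b bu].
  (* A weight vector of nonzero degree commutes with z. One of degree 0 preserves degrees under
     bracket, so it preserves the centralizer. *)
  have [ctb|ctb] := eqVneq (cart t b) 0; last first.
    by rewrite (cent_deg _ _ _ bu zc ctb) mem0v.
  apply: commutes_XY => i iT; have [Xz Yz] := XYx z i zc iT.
  split; rewrite lie_leibniz ?Xz ?Yz lie_br0r addr0.
    apply: cent_deg (root_space_br (pos_vec i) bu) zc _.
    by rewrite cartD ctb addr0 -in_T.
  apply: cent_deg (root_space_br (Y_neg i) bu) zc _.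
  by rewrite cartD ctb addr0 cartN oppr_eq0 -in_T.
- by rewrite memv0 => /eqP.
case/eqP: (coroot_neq0 t).
have Xt_cent : X t \in centralizer XYT by rewrite cf memvf.
have [_] := XYx (X t) t Xt_cent tT.
rewrite lie_brC => /eqP; rewrite oppr_eq0 -corootE => /eqP H0.
have -> : coroot t = 0 by apply: val_inj; rewrite /= H0.
by rewrite linear0.
Qed.

Let sS := {i : 'I_d | i \in half_set}.
Let I : finType := (option bool + bool * sS + sS * sS)%type.

(** These vectors generate enough of the grading: all root vectors of nonzero degree, and their
    brackets of degree 0. They are shown to span g by having no nonzero orthogonal vector. *)
Definition spanning_vec (k : I) : g :=
  match k with
  | inl (inl None) => [lie X t, Y t]
  | inl (inl (Some e)) => if e then X t else Y t
  | inl (inr (e, s)) => if e then X (val s) else Y (val s)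
  | inr (s, s') => [lie X (val s), Y (val s')]
  end.

(** By invariance, such an x has zero bracket with every root vector of nonzero degree, and
    [centralizer_eq0] applies. *)
Lemma spanning_vec_orthogonal x : (forall k, B x (spanning_vec k) = 0) -> x = 0.
Proof.
move=> x_orth.
have BX i : i \in T -> B x (X i) = 0 /\ B x (Y i) = 0.
  rewrite inE in_set1 => /orP[/eqP->|iS].
    by split; [apply: (x_orth (inl (inl (Some true))))
              |apply: (x_orth (inl (inl (Some false))))].
  by split; [apply: (x_orth (inl (inr (true, exist _ i iS))))
            |apply: (x_orth (inl (inr (false, exist _ i iS))))].
have BXY i j : i \in T -> j \in T -> cart t (a i) = cart t (a j) ->
    B x [lie X i, Y j] = 0.
  have half_cart_neq k : k \in half_set -> cart t (a k) != c.
    move=> kS; apply/eqP => e; have := half_cart kS.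
    rewrite e mulr2n => /eqP; rewrite -subr_eq0 addrK.
    by rewrite (negPf (coroot_neq0 t)).
  rewrite /T !in_setU1 => /orP[/eqP->|iS] /orP[/eqP->|jS].
  - by move=> _; apply: (x_orth (inl (inl None))).
  - by move/esym/eqP; rewrite (negPf (half_cart_neq j jS)).
  - by move/eqP; rewrite (negPf (half_cart_neq i iS)).
  by move=> _; apply: (x_orth (inr (exist _ i iS, exist _ j jS))).
have deg_orth (b : W) u : rs b u -> cart t b != 0 -> B x u = 0.
  move=> bu ctb; have [->|u0] := eqVneq u 0; first by rewrite (inv0r B_inv).
  by have [i iT [[_ [m ->]]|[_ [m ->]]]] := nonzero_cart bu u0 ctb;
    have [Xz Yz] := BX i iT; rewrite (invZr B_inv) ?Xz ?Yz mulr0.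
apply: centralizer_eq0; apply: commutes_XY => i iT.
have ci0 : cart t (a i) != 0 by rewrite -in_T.
(* As B([w, x], u) = - B(x, [w, u]), only weight vectors u of degree opposite to w need attention:
   otherwise [w, u] has nonzero degree. *)
have orth_br (w : g) (b : W) : rs b w -> cart t b != 0 ->
    (forall b' u, rs b' u -> u != 0 -> cart t b + cart t b' = 0 -> B x [lie w, u] = 0) ->
  [lie w, x] = 0.
  move=> bw cb0 opp; apply: (inv_nondeg B_inv) => y.
  have [s [sW ->]] := weight_decomposition h_cartan y.
  rewrite (inv_sumr B_inv) big_seq big1 // => u /sW[b' bu].
  rewrite (inv_brC B_inv); apply/eqP; rewrite oppr_eq0; apply/eqP.
  have [->|u0] := eqVneq u 0; first by rewrite lie_br0r (inv0r B_inv).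
  have [e|ne] := eqVneq (cart t b + cart t b') 0; first exact: opp bu u0 e.
  by apply: deg_orth (root_space_br bw bu) _; rewrite cartD.
have cart_pos k : k \in T -> exists m, (0 < m)%N /\ cart t (a k) *+ 2 = c *+ m.
  rewrite inE in_set1 => /orP[/eqP->|kS]; first by exists 2%N.
  by exists 1%N; rewrite half_cart.
have cart_add_neq0 j k : j \in T -> k \in T -> cart t (a j) + cart t (a k) != 0.
  move=> /cart_pos[m [m0 me]] /cart_pos[n [n0 ne]]; apply/eqP => e.
  have : c *+ (m + n) = 0 by rewrite mulrnDr -me -ne -mulrnDl e mul0rn.
  by move/mulrn_coroot_eq0 => mn; rewrite -(ltn_add2l m) addn0 mn in n0.
split.
  apply: (orth_br _ _ (pos_vec i) ci0) => b' u bu u0 e.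
  have cb' : cart t b' != 0 by apply: contraNneq ci0 => b'0; rewrite -e b'0 addr0.
  have [j jT [[be _]|[be [m ->]]]] := nonzero_cart bu u0 cb'.
    by have := cart_add_neq0 i j iT jT; rewrite -be e eqxx.
  rewrite lie_brZr (invZr B_inv) BXY ?mulr0 //.
  by move/eqP: e; rewrite be cartN subr_eq0 => /eqP.
have cNi : cart t (- a i) != 0 by rewrite cartN oppr_eq0.
apply: (orth_br _ _ (Y_neg i) cNi) => b' u bu u0 e.
have cb' : cart t b' != 0 by apply: contraNneq cNi => b'0; rewrite -e b'0 addr0.
have [j jT [[be [m ->]]|[be _]]] := nonzero_cart bu u0 cb'.
  rewrite lie_brZr (invZr B_inv) lie_brC -scaleN1r (invZr B_inv) BXY ?mulr0 //.
  by move/eqP: e; rewrite be cartN addrC subr_eq0 => /eqP.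
have := cart_add_neq0 i j iT jT; rewrite -oppr_eq0 opprD -!cartN -be e eqxx //.
Qed.

Lemma dim_le_half : (\dim {:g} <= 3 + 2 * #|half_set| + #|half_set| ^ 2)%N.
Proof.
pose f w (x : g) : K^o := B x w.
have f_lin w : linear (f w) by move=> e x y; rewrite /f (inv_linearl B_inv).
pose fM w := GRing.isLinear.Build _ _ _ _ (f w) (f_lin w).
pose fL w : {linear g -> K^o} := HB.pack (f w) (fM w).
have := @joint_injective_dim _ _ I (fun k => linfun (fL (spanning_vec k))).
have -> : #|I| = (3 + 2 * #|half_set| + #|half_set| ^ 2)%N.
  by rewrite !card_sum !card_prod card_option card_bool card_sig mulnn.
apply=> x x0; apply: spanning_vec_orthogonal => k.
by have := x0 k; rewrite lfunE.
Qed.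

End CentralRootVector.

Lemma inv_XY i j : B (X i) (Y j) = (i == j)%:R.
Proof.
have [->|ij] := eqVneq i j; first exact: XY.
apply: (root_space_orthogonal B_inv (pos_vec i) (Y_neg j)).
by rewrite subr_eq0; apply: contra_neq ij; apply: pos_root_inj.
Qed.

Lemma inv_YY i j : B (Y i) (Y j) = 0.
Proof.
apply: (root_space_orthogonal B_inv (Y_neg i) (Y_neg j)).
by rewrite -opprD oppr_eq0 pos_root_sum_neq0.
Qed.

Lemma inv_sumXY (e : 'I_d -> K) j : B (\sum_i e i *: X i) (Y j) = e j.
Proof.
rewrite (inv_suml B_inv) (bigD1 j) //= (invZl B_inv) XY mulr1 big1 ?addr0 // => i ij.
by rewrite (invZl B_inv) inv_XY (negPf ij) mulr0.
Qed.

(** The coefficient e_k is B([X_i, X_j], Y_k), which vanishes unless the weights are opposite. *)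
Lemma structure_constant_support (e : 'I_d -> K) i j k :
  [lie X i, X j] = \sum_l e l *: X l -> e k != 0 -> a k = a i + a j.
Proof.
move=> eE; rewrite -(inv_sumXY e k) -eE; apply: contraNeq => ne.
apply/eqP; apply: (root_space_orthogonal B_inv (root_space_br (pos_vec i) (pos_vec j))
  (Y_neg k)).
by rewrite subr_eq0 eq_sym.
Qed.

Lemma inv_cartan (i : 'I_d) u : u \in h -> B u (X i) = 0 /\ B u (Y i) = 0.
Proof.
have [h_ab _ _] := h_cartan => uh.
have u0 : rs 0 u by move=> t; rewrite h_ab ?subvsP // zero_lfunE scale0r.
split; [apply: (root_space_orthogonal B_inv u0 (pos_vec i))
       |apply: (root_space_orthogonal B_inv u0 (Y_neg i))].
  by rewrite add0r pos_root_neq0.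
by rewrite add0r oppr_eq0 pos_root_neq0.
Qed.

(** An element of h killed by all positive roots is central, so the d positive roots are jointly
    injective on h. *)
Lemma rank_le : (0 < d)%N -> (\dim h <= d)%N.
Proof.
move=> d_gt0.
have := @joint_injective_dim _ _ 'I_d (fun i => a i); rewrite dimvf card_ord; apply.
move=> t t0; apply/val_inj/center_eq0 => // x /=; rewrite lie_brC.
apply/eqP; rewrite oppr_eq0; apply/eqP.
apply: (weight_vectors_span (f := lie_br (vsval t))) => b u bu.
have [->|u0] := eqVneq u 0; first by rewrite /= lie_br0r.
rewrite /= bu; have [->|[i [->|->]]] := weight_cases bu u0.
- by rewrite zero_lfunE scale0r.
- by rewrite t0 scale0r.
by rewrite opp_lfunE t0 oppr0 scale0r.
Qed.

Lemma rank_gt0 : (0 < d)%N -> (0 < \dim h)%N.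
Proof.
move=> d_gt0; rewrite lt0n dimv_eq0; apply/eqP => h0.
case/eqP: (pos_root_neq0 (Ordinal d_gt0)); apply/lfunP => t.
have -> : t = 0; last by rewrite !linear0.
by apply: val_inj; apply/eqP; rewrite /= -memv0 -h0 subvsP.
Qed.

Definition root_basis : seq g :=
  (vbasis h : seq g) ++ [seq X i | i <- enum 'I_d] ++ [seq Y i | i <- enum 'I_d].

Lemma root_basis_span : <<root_basis>>%VS = fullv.
Proof.
apply/eqP; rewrite eqEsubv subvf; apply/subvP => w _.
have [s [sW ->]] := weight_decomposition h_cartan w.
rewrite big_seq memv_suml // => u /sW[b bu].
have [->|u0] := eqVneq u 0; first exact: mem0v.
rewrite !span_cat; have [b0|[i [e|e]]] := weight_cases bu u0.
- rewrite b0 in bu; have uh := centralizer_cartan h_cartan bu.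
  by rewrite (subvP (addvSl _ _)) // (span_basis (vbasisP h)).
- rewrite e in bu; rewrite (pos_spaceE bu) memvZ //.
  rewrite (subvP (addvSr _ _)) // (subvP (addvSl _ _)) // memv_span //.
  by apply: map_f; rewrite mem_enum.
rewrite e in bu; rewrite (neg_spaceE bu) memvZ //.
rewrite (subvP (addvSr _ _)) // (subvP (addvSr _ _)) // memv_span //.
by apply: map_f; rewrite mem_enum.
Qed.

Lemma dim_roots : \dim {:g} = (\dim h + 2 * d)%N.
Proof.
apply/eqP; rewrite eqn_leq; apply/andP; split.
  rewrite -root_basis_span (leq_trans (dim_span _)) //.
  by rewrite /root_basis !size_cat !(size_map, size_tuple) -enumT size_enum_ord mul2n addnn.
pose v (k : 'I_(\dim h) + ('I_d + 'I_d)) : g :=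
  match k with
  | inl i => (vbasis h)`_i
  | inr (inl i) => X i
  | inr (inr i) => Y i
  end.
have := @independent_dim _ _ _ v; rewrite !card_sum !card_ord addnn mul2n; apply.
move=> k; rewrite big_sumType big_sumType /=.
set u := \sum_(i < _) _; set p := \sum_(i < d) _; set n := \sum_(i < d) _ => e.
have uh : u \in h.
  by apply: memv_suml => i _; rewrite memvZ // vbasis_mem // mem_nth ?size_tuple.
have kX i : k (inr (inl i)) = 0.
  have := inv_sumXY (k \o inr \o inl) i; rewrite -/p /= => <-.
  have -> : p = - u - n by apply/eqP; rewrite -subr_eq0 -opprD opprK addrCA e.
  rewrite -opprD -scaleN1r (invZl B_inv) (invDl B_inv) (inv_cartan i uh).2 add0r.
  rewrite (inv_suml B_inv) big1 ?mulr0 // => j _.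
  by rewrite (invZl B_inv) inv_YY mulr0.
have p0 : p = 0 by rewrite /p big1 // => i _; rewrite kX scale0r.
have kY i : k (inr (inr i)) = 0.
  have : B (X i) (u + (p + n)) = 0 by rewrite e (inv0r B_inv).
  rewrite p0 add0r (invDr B_inv) (inv_sym B_inv) (inv_cartan i uh).1 add0r.
  rewrite (inv_sumr B_inv) (bigD1 i) //= (invZr B_inv) XY mulr1 big1 ?addr0 //.
  by move=> j ji; rewrite (invZr B_inv) inv_XY eq_sym (negPf ji) mulr0.
have n0 : n = 0 by rewrite /n big1 // => i _; rewrite kY scale0r.
move: e; rewrite p0 n0 !addr0 => e [i|[i|i]] //.
by have /freeP free_h := basis_free (vbasisP h); apply: (free_h (k \o inl) e i).
Qed.

End Roots.

(** * Simplicity of the classical Lie algebras *)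

Section MatrixIdeals.
Variables (K : numFieldType) (m : nat).
Implicit Types (A B : 'M[K]_m) (P J : 'M[K]_m -> Prop).

Definition mx_lie_ideal P J : Prop :=
  [/\ forall e A B, J A -> J B -> J (e *: A + B),
      forall A, J A -> P A
    & forall A B, P A -> J B -> J (A *m B - B *m A)].

Definition mx_lie_simple P : Prop :=
  forall J, mx_lie_ideal P J -> forall A, J A -> A != 0 -> forall B, P B -> J B.

Section Ideal.
Variables (P J : 'M[K]_m -> Prop).
Hypothesis JP : mx_lie_ideal P J.

Lemma mx_lie_ideal0 A : J A -> J 0.
Proof. by case: JP => lin _ _ JA; have := lin (-1) A A JA JA; rewrite scaleN1r addNr. Qed.

Lemma mx_lie_idealZ e A : J A -> J (e *: A).
Proof.
by case: JP => lin _ _ JA; have := lin e A 0 JA (mx_lie_ideal0 JA); rewrite addr0.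
Qed.

Lemma mx_lie_idealZ_inv e A : e != 0 -> J (e *: A) -> J A.
Proof. by move=> e0 /(mx_lie_idealZ e^-1); rewrite scalerA mulVf // scale1r. Qed.

Lemma mx_lie_idealD A B : J A -> J B -> J (A + B).
Proof. by case: JP => lin _ _ JA JB; rewrite -[A]scale1r; apply: lin. Qed.

Lemma mx_lie_idealN A : J A -> J (- A).
Proof. by rewrite -scaleN1r; apply: mx_lie_idealZ. Qed.

Lemma mx_lie_ideal_sum (I : finType) (Q : pred I) (F : I -> 'M[K]_m) A :
  J A -> (forall i, Q i -> J (F i)) -> J (\sum_(i | Q i) F i).
Proof. by move=> /mx_lie_ideal0 J0 JF; apply: big_ind => //; apply: mx_lie_idealD. Qed.

End Ideal.

Lemma delta_mulE (A : 'M[K]_m) (i j k l : 'I_m) :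
  (delta_mx i j *m A) k l = (k == i)%:R * A j l.
Proof.
rewrite mxE (bigD1 j) //= mxE eqxx andbT big1 ?addr0 // => z zj.
by rewrite mxE (negPf zj) andbF mul0r.
Qed.

Lemma mul_deltaE (A : 'M[K]_m) (i j k l : 'I_m) :
  (A *m delta_mx i j) k l = A k i * (l == j)%:R.
Proof.
rewrite mxE (bigD1 i) //= mxE eqxx big1 ?addr0 // => z zi.
by rewrite mxE (negPf zi) mulr0.
Qed.

Lemma subr_mxE (A B : 'M[K]_m) k l : (A - B) k l = A k l - B k l.
Proof. by rewrite !mxE. Qed.

(** An off-diagonal entry of A yields an elementary matrix by a double bracket, a nonscalar diagonal
    A by a single one; a scalar matrix of trace 0 is 0. Brackets then spread this elementary matrix
    to all positions. *)
Lemma sl_mx_simple : mx_lie_simple (@sl_mx K m).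
Proof.
move=> J JP A JA A0.
have [_ J_sl J_br] := JP.
have E_sl i j : i != j -> sl_mx (delta_mx i j : 'M[K]_m).
  move=> ij; rewrite /sl_mx /mxtrace big1 // => k _; rewrite mxE.
  by case: eqP => // ->; rewrite (negPf ij).
have double i j B : i != j -> B j i != 0 -> J B -> J (delta_mx i j).
  move=> ij Bji JB; have e0 : - (2%:R * B j i) != 0.
    by rewrite oppr_eq0 mulf_neq0 // pnatr_eq0.
  apply: (mx_lie_idealZ_inv JP e0).
  have -> : - (2%:R * B j i) *: delta_mx i j =
      delta_mx i j *m (delta_mx i j *m B - B *m delta_mx i j)
      - (delta_mx i j *m B - B *m delta_mx i j) *m delta_mx i j.
    apply/matrixP => k l; rewrite !(subr_mxE, delta_mulE, mul_deltaE).
    rewrite [LHS]mxE [delta_mx i j k l]mxE [j == i]eq_sym (negPf ij).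
    by case: (k == i); case: (l == j) => /=; ring.
  by apply: (J_br); [apply: E_sl|apply: (J_br) => //; apply: E_sl].
have [i [j [ij JE]]] : exists i j, i != j /\ J (delta_mx i j).
  have [[i [j [ij Aji]]]|Adiag] := pselect (exists i j, i != j /\ A j i != 0).
    by exists i, j; split=> //; apply: double Aji JA.
  have A_ij i j : i != j -> A i j = 0.
    move=> ij; apply/eqP; apply: contraT => Aij; case: Adiag; exists j, i.
    by rewrite eq_sym.
  have [[i [j Aij]]|Ascal] := pselect (exists i j, A i i != A j j).
    have ij : i != j by apply: contraNneq Aij => ->.
    exists i, j; split=> //; have e0 : A j j - A i i != 0 by rewrite subr_eq0 eq_sym.
    apply: (mx_lie_idealZ_inv JP e0).
    have -> : (A j j - A i i) *: delta_mx i j =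
        delta_mx i j *m A - A *m delta_mx i j :> 'M[K]_m.
      apply/matrixP => k l; rewrite subr_mxE delta_mulE mul_deltaE !mxE.
      have [->|ki] := eqVneq k i; have [->|lj] := eqVneq l j => /=.
      - by ring.
      - by rewrite (A_ij j l) 1?eq_sym //; ring.
      - by rewrite (A_ij k i) //; ring.
      by ring.
    by apply: J_br => //; apply: E_sl.
  case/eqP: A0; apply/matrixP => i j; rewrite mxE.
  have [<-|/A_ij//] := eqVneq i j.
  have := J_sl A JA; rewrite /sl_mx /mxtrace.
  have -> : \sum_k A k k = \sum_(k < m) A i i.
    apply: eq_bigr => k _; apply/eqP; apply: contraT => Aki.
    by case: Ascal; exists k, i.
  rewrite sumr_const card_ord => /eqP; rewrite mulrn_eq0 => /orP[/eqP m0|/eqP //].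
  by exfalso; have := leq_ltn_trans (leq0n i) (ltn_ord i); rewrite m0.
have J_tr k l : k != l -> J (delta_mx k l) -> J (delta_mx l k).
  move=> kl JE'; apply: (double l k (delta_mx k l)) => //; first by rewrite eq_sym.
  by rewrite mxE !eqxx oner_eq0.
have J_row k l z : k != l -> z != l -> J (delta_mx k l) -> J (delta_mx z l).
  move=> kl zl JE'; have [->//|zk] := eqVneq z k.
  have := J_br _ _ (E_sl _ _ zk) JE'.
  by rewrite mul_delta_mx mul_delta_mx_0 1?eq_sym // subr0.
have J_all k l : k != l -> J (delta_mx k l).
  move=> kl; have Jk z : z != k -> J (delta_mx z k) -> J (delta_mx k l).
    by move=> zk /(J_row _ _ l zk); rewrite eq_sym => /(_ kl)/J_tr; apply; rewrite eq_sym.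
  have [ek|kj] := eqVneq k j; first by apply: (Jk i); rewrite ek.
  by apply: (Jk j); [rewrite eq_sym|apply: J_tr => //; apply: J_row JE].
have J_diag k l : k != l -> J (delta_mx k k - delta_mx l l).
  move=> kl; have lk : l != k by rewrite eq_sym.
  by have := J_br _ _ (E_sl _ _ kl) (J_all _ _ lk); rewrite !mul_delta_mx.
move=> B trB.
(* Trace 0 allows subtracting the same E_ii from every diagonal unit. *)
have -> : B = \sum_k \sum_(l | l != k) B k l *: delta_mx k l
            + \sum_k B k k *: (delta_mx k k - delta_mx i i).
  have -> : \sum_k B k k *: (delta_mx k k - delta_mx i i) =
            \sum_k B k k *: delta_mx k k :> 'M[K]_m.
    under eq_bigr => k _ do rewrite scalerBr.
    rewrite sumrB -scaler_suml; move: trB; rewrite /sl_mx /mxtrace => ->.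
    by rewrite scale0r subr0.
  rewrite -big_split /= {1}[B]matrix_sum_delta; apply: eq_bigr => k _.
  by rewrite (bigD1 k) //= addrC.
apply: (mx_lie_idealD JP).
  apply: (mx_lie_ideal_sum JP JA) => k _; apply: (mx_lie_ideal_sum JP JA) => l lk.
  by apply/(mx_lie_idealZ JP)/J_all; rewrite eq_sym.
apply: (mx_lie_ideal_sum JP JA) => k _; apply: (mx_lie_idealZ JP).
have [->|ki] := eqVneq k i; last exact: J_diag.
by rewrite subrr; apply: (mx_lie_ideal0 JP JA).
Qed.

End MatrixIdeals.

(** * Simplicity of so(m) *)

Section Orthogonal.
Variables (K : numFieldType) (m : nat).

Definition so_gen (i j : 'I_m) : 'M[K]_m := delta_mx i j - delta_mx j i.

Lemma so_gen_so i j : so_mx (so_gen i j).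
Proof. by rewrite /so_mx /so_gen linearB /= !trmx_delta opprB. Qed.

Lemma so_genC i j : so_gen i j = - so_gen j i.
Proof. by rewrite /so_gen opprB. Qed.

Lemma so_mxE (A : 'M[K]_m) i j : so_mx A -> A i j = - A j i.
Proof. by move/matrixP/(_ j i); rewrite !mxE. Qed.

Lemma so_gen_brE i j (A : 'M[K]_m) k l :
  (so_gen i j *m A - A *m so_gen i j) k l =
    (k == i)%:R * A j l - (k == j)%:R * A i l
    - (A k i * (l == j)%:R - A k j * (l == i)%:R).
Proof.
by rewrite subr_mxE /so_gen mulmxBl mulmxBr !subr_mxE !delta_mulE !mul_deltaE.
Qed.

Definition separates (i j k l : 'I_m) := ((k == i) || (k == j)) (+) ((l == i) || (l == j)).

(* The square of ad (so_gen i j) is minus the projection onto the span of the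
   so_gen k l such that {k, l} meets {i, j} in exactly one point. *)
Lemma so_gen_br2E i j (A : 'M[K]_m) k l : i != j -> so_mx A ->
  (so_gen i j *m (so_gen i j *m A - A *m so_gen i j)
   - (so_gen i j *m A - A *m so_gen i j) *m so_gen i j) k l =
  - ((separates i j k l)%:R * A k l).
Proof.
move=> ij soA; have ji : (j == i) = false by rewrite eq_sym (negPf ij).
have A0 z : A z z = 0.
  by apply/eqP; have /eqP := so_mxE z z soA; rewrite -addr_eq0 -mulr2n mulrn_eq0.
rewrite so_gen_brE !so_gen_brE /separates !eqxx ji (negPf ij).
have [->|ki] := eqVneq k i; have [->|li] := eqVneq l i.
- by rewrite (negPf ij) !A0 /=; ring.
- have [->|lj] := eqVneq l j; rewrite ?(negPf ij) ?A0 /= ?(so_mxE j i soA); ring.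
- have [->|kj] := eqVneq k j; rewrite ?(negPf ij) ?A0 /= ?(so_mxE j i soA); ring.
have [->|kj] := eqVneq k j; have [->|lj] := eqVneq l j;
  rewrite ?A0 /= ?(so_mxE j i soA); ring.
Qed.

Lemma exists_notin (s : seq 'I_m) : (size s < m)%N -> exists x, x \notin s.
Proof.
move=> sm; apply: contrapT => /forallNP ins.
have : (#|'I_m| <= size s)%N.
  rewrite cardE uniq_leq_size ?enum_uniq // => x _.
  by have /negP := ins x; rewrite negbK.
by rewrite card_ord leqNgt sm.
Qed.

(** Double brackets act as projections up to sign, and composing them isolates one generator from a
    nonzero entry of A. The bound on m is sharp: so(4) is a sum of two proper ideals. *)
Lemma so_mx_simple : (5 <= m)%N -> mx_lie_simple (@so_mx K m).
Proof.
move=> m5 J JP A JA A0; have [_ J_so J_br] := JP.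
have soA := J_so A JA.
have [p [q Apq]] : exists p q, A p q != 0.
  apply: contrapT => NA; case/eqP: A0; apply/matrixP => p q; rewrite mxE.
  by apply/eqP; apply: contraT => Apq; case: NA; exists p, q.
have pq : p != q.
  apply: contraNneq Apq => ->.
  by have /eqP := so_mxE q q soA; rewrite -addr_eq0 -mulr2n mulrn_eq0.
have [r] := @exists_notin [:: p; q] (leq_trans (isT : 2 < 5)%N m5).
rewrite !inE !negb_or => /andP[rp rq].
have [s] := @exists_notin [:: p; q; r] (leq_trans (isT : 3 < 5)%N m5).
rewrite !inE !negb_or => /and3P[sp sq sr].
have [u] := @exists_notin [:: p; q; r; s] (leq_trans (isT : 4 < 5)%N m5).
rewrite !inE !negb_or => /and4P[up uq ur us].
pose D i j (C : 'M[K]_m) := so_gen i j *m (so_gen i j *m C - C *m so_gen i j)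
   - (so_gen i j *m C - C *m so_gen i j) *m so_gen i j.
have JD i j C : J C -> J (D i j C).
  by move=> JC; apply: (J_br); [|apply: (J_br)]; first [exact: so_gen_so | exact: JC].
have Jpq : J (so_gen p q).
  apply: (mx_lie_idealZ_inv JP Apq).
  (* Only {p, q} meets each of {p, r}, {p, s}, {p, u}, {q, r} in one point: this
     is where five indices are needed. *)
  have -> : A p q *: so_gen p q = D p r (D p s (D p u (D q r A))).
    have DE i j C k l : i != j -> J C ->
        D i j C k l = - ((separates i j k l)%:R * C k l).
      by move=> ij JC; apply: so_gen_br2E => //; apply: J_so.
    have J1 := JD q r A JA; have J2 := JD p u _ J1; have J3 := JD p s _ J2.
    have [pr ps pu qr] : [/\ p != r, p != s, p != u & q != r].
      by rewrite !(eq_sym p) (eq_sym q).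
    apply/matrixP => k l; rewrite !DE //.
    rewrite /separates [LHS]mxE [so_gen p q k l]subr_mxE.
    rewrite [delta_mx p q k l]mxE [delta_mx q p k l]mxE.
    rewrite !mulrN !opprK !mulrA -!natrM !mulnb.
    have neqs := (negPf pq, negPf rp, negPf rq, negPf sp, negPf sq, negPf sr,
                  negPf up, negPf uq, negPf ur, negPf us).
    have neqs' : ((q == p) = false) * ((p == r) = false) * ((q == r) = false)
        * ((p == s) = false) * ((q == s) = false) * ((r == s) = false)
        * ((p == u) = false) * ((q == u) = false) * ((r == u) = false)
        * ((s == u) = false).
      by do !split; rewrite eq_sym neqs.
    have [->|kp] := eqVneq k p.
      have [->|lq] := eqVneq l q.
        by rewrite !(eqxx, neqs, neqs') /=; ring.
      have [->|lp] := eqVneq l p; first by rewrite !(eqxx, neqs, neqs') /=; ring.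
      rewrite !(eqxx, neqs, neqs', negPf lq, negPf lp) /=.
      by case: (l == r); case: (l == s); case: (l == u) => /=; ring.
    have [->|lp] := eqVneq l p.
      have [->|kq] := eqVneq k q.
        by rewrite !(eqxx, neqs, neqs') /= (so_mxE q p soA); ring.
      rewrite !(eqxx, neqs, neqs', negPf kq, negPf kp) /=.
      by case: (k == r); case: (k == s); case: (k == u) => /=; ring.
    have [->|kr] := eqVneq k r; [|have [->|ks] := eqVneq k s;
      [|have [->|ku] := eqVneq k u]];
      (have [->|lr] := eqVneq l r; [|have [->|ls] := eqVneq l s;
      [|have [->|lu] := eqVneq l u]]);
      rewrite ?(eqxx, neqs, neqs') ?andbF /= ?subrr ?mulr0 ?mul0r //.
  by exact: (JD _ _ _ (JD _ _ _ (JD _ _ _ (JD _ _ _ JA)))).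
have J_swap i j : J (so_gen i j) -> J (so_gen j i).
  by rewrite (so_genC j i); exact: (mx_lie_idealN JP).
have J_next i j k : k != i -> k != j -> i != j -> J (so_gen i j) -> J (so_gen i k).
  move=> ki kj ij JR; have := J_br _ _ (so_gen_so j k) JR.
  move=> /(mx_lie_idealN JP).
  suff -> : - (so_gen j k *m so_gen i j - so_gen i j *m so_gen j k) = so_gen i k by [].
  rewrite /so_gen !mulmxBl !mulmxBr !mul_delta_mx_cond !eqxx.
  rewrite [j == k]eq_sym [i == k]eq_sym [j == i]eq_sym (negPf ki) (negPf kj) (negPf ij).
  by rewrite !mulr1n !mulr0n !(subr0, sub0r) opprK addrC opprD opprK.
have Jp k : k != p -> J (so_gen p k).
  by move=> kp; have [->//|kq] := eqVneq k q; apply: J_next kp kq pq Jpq.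
have J_all k l : k != l -> J (so_gen k l).
  move=> kl; have [ek|kp] := eqVneq k p.
    by rewrite ek; apply: Jp; rewrite eq_sym -ek.
  have [->|lp] := eqVneq l p; first exact/J_swap/Jp.
  by apply: J_next lp kp (J_swap _ _ (Jp k kp)); rewrite eq_sym.
move=> B soB.
have -> : B = 2%:R^-1 *: \sum_k \sum_l B k l *: so_gen k l.
  have two0 : 2%:R != 0 :> K by rewrite pnatr_eq0.
  have -> : \sum_k \sum_l B k l *: so_gen k l = B - B^T.
    rewrite [X in _ = X - _]matrix_sum_delta [X in _ = _ - X]matrix_sum_delta.
    rewrite [X in _ = _ - X]exchange_big -sumrB /=.
    apply: eq_bigr => k _; rewrite -sumrB; apply: eq_bigr => l _.
    by rewrite mxE /so_gen scalerBr.
  by rewrite soB opprK -mulr2n -scaler_nat scalerA mulVf ?scale1r.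
apply: (mx_lie_idealZ JP); apply: (mx_lie_ideal_sum JP JA) => k _.
apply: (mx_lie_ideal_sum JP JA) => l _; apply: (mx_lie_idealZ JP).
have [->|kl] := eqVneq k l; last exact: J_all.
by rewrite /so_gen subrr; apply: (mx_lie_ideal0 JP JA).
Qed.

End Orthogonal.

(** * Simplicity of sp(2n) *)

Section Symplectic.
Variables (K : numFieldType) (n : nat).
Notation J := (sp_form K n).
Notation vec := 'cV[K]_(n + n).
Implicit Types (u v w : vec) (A B : 'M[K]_(n + n)).

Lemma sp_form_tr : J^T = - J.
Proof.
by rewrite /sp_form tr_block_mx opp_block_mx !trmx0 linearN /= trmx1 !oppr0 opprK.
Qed.

Lemma sp_form_sqr : J *m J = - 1%:M.
Proof.
rewrite /sp_form mulmx_block !(mul0mx, mulmx0, mulmx1, mul1mx, addr0, add0r, mulNmx, mulmxN).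
by rewrite [in RHS]scalar_mx_block opp_block_mx !oppr0.
Qed.

(** The identification of the symmetric square of the standard representation with sp(2n); [sq_br]
    is its equivariance. *)
Definition sq u v : 'M[K]_(n + n) := (u *m v^T + v *m u^T) *m J.
Definition om u v : K := (u^T *m J *m v) 0 0.

Lemma sqC u v : sq u v = sq v u.
Proof. by rewrite /sq addrC. Qed.

Lemma om_scalar u v : u^T *m J *m v = (om u v)%:M.
Proof. exact: mx11_scalar. Qed.

Lemma omC u v : om u v = - om v u.
Proof.
rewrite /om -[u^T *m J *m v]trmxK mxE !trmx_mul trmxK sp_form_tr mulNmx mulmxN.
by rewrite mxE mulmxA.
Qed.

Lemma om_self u : om u u = 0.
Proof. by have /eqP := omC u u; rewrite -addr_eq0 -mulr2n mulrn_eq0 => /eqP. Qed.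

Lemma sq_mul u v w : sq u v *m w = om v w *: u + om u w *: v.
Proof.
by rewrite /sq !mulmxDl -!mulmxA !(mulmxA _ J) !om_scalar !mul_mx_scalar.
Qed.

Lemma sq_sp u v : sp_mx (sq u v).
Proof.
rewrite /sp_mx /sq trmx_mul linearD /= !trmx_mul !trmxK sp_form_tr mulNmx.
by rewrite mulNmx addrC mulmxA [v *m u^T + _]addrC addrN.
Qed.

Lemma sp_mxE A : sp_mx A -> J *m A = - (A^T *m J).
Proof. by rewrite /sp_mx addrC => /eqP; rewrite addr_eq0 => /eqP. Qed.

Lemma sq_br A u v : sp_mx A ->
  A *m sq u v - sq u v *m A = sq (A *m u) v + sq u (A *m v).
Proof.
move=> /sp_mxE JA; rewrite /sq -[_ *m J *m A]mulmxA JA mulmxN opprK !mulmxA -!mulmxDl.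
congr (_ *m J); rewrite mulmxDr mulmxDl !trmx_mul !mulmxA.
by rewrite [X in _ + X = _]addrC addrACA; congr (_ + _); rewrite addrC.
Qed.

Lemma sqZl e u v : sq (e *: u) v = e *: sq u v.
Proof. by rewrite /sq linearZ /= -scalemxAl -scalemxAr -scalerDr scalemxAl. Qed.

Lemma sp_lin e A B : sp_mx A -> sp_mx B -> sp_mx (e *: A + B).
Proof.
rewrite /sp_mx => spA spB; rewrite linearP /= mulmxDl mulmxDr -scalemxAl -scalemxAr.
by rewrite addrACA -scalerDr spA spB scaler0 addr0.
Qed.

Lemma om_nondeg u : u != 0 -> exists w, om w u = 1.
Proof.
move=> u0; have [i Jui] : exists i, (J *m u) i 0 != 0.
  apply: contrapT => NJ; case/eqP: u0.
  have Ju : J *m u = 0.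
    apply/colP => i; rewrite [RHS]mxE; apply/eqP; apply: contraT => Ji.
    by case: NJ; exists i.
  by rewrite -[u]mul1mx -[1%:M]opprK -sp_form_sqr mulNmx -mulmxA Ju mulmx0 oppr0.
exists (((J *m u) i 0)^-1 *: delta_mx i 0).
rewrite /om linearZ /= -!scalemxAl -mulmxA trmx_delta -rowE [LHS]mxE [row _ _ _ _]mxE.
exact: mulVf.
Qed.

Lemma omDl u v w : om (u + v) w = om u w + om v w.
Proof. by rewrite /om linearD /= !mulmxDl mxE. Qed.

Lemma omDr u v w : om w (u + v) = om w u + om w v.
Proof. by rewrite /om mulmxDr mxE. Qed.

Lemma om_sp A u v : sp_mx A -> om u (A *m v) = om v (A *m u).
Proof.
move=> /sp_mxE JA; rewrite [RHS]omC /om trmx_mul mulmxA -(mulmxA _ J A) JA.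
by rewrite mulmxN mulNmx mxE !mulmxA.
Qed.

(** If om w u = 1, then [sq v w] sends u to v + c w and [sq w w] sends it to 2 w. *)
Lemma sp_transitive u v : u != 0 -> exists2 B, sp_mx B & B *m u = v.
Proof.
move=> /om_nondeg[w wu]; pose c := om v u.
exists (sq v w - (c / 2%:R) *: sq w w).
  by rewrite addrC -scaleNr; apply: sp_lin; apply: sq_sp.
rewrite mulmxBl -scalemxAl !sq_mul wu -/c -scalerDl scalerA !scale1r.
by rewrite [c / 2%:R * _](_ : _ = c) ?addrK //; field.
Qed.

(** The bilinear form om(u, A v) is symmetric and nonzero, so om(u, A u) is nonzero for some u. The
    double bracket of [sq u u] with A is then a nonzero multiple of [sq u u], and transitivity on
    vectors moves both arguments anywhere. *)
Lemma sp_mx_simple : mx_lie_simple (@sp_mx K n).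
Proof.
move=> I IP A IA A0; have [_ I_sp I_br] := IP; have spA := I_sp A IA.
have two0 : 2%:R != 0 :> K by rewrite pnatr_eq0.
have [u q0] : exists u, om u (A *m u) != 0.
  apply: contrapT => Nq; case/eqP: A0.
  have q_0 u : om u (A *m u) = 0.
    by apply/eqP; apply: contraT => qu; case: Nq; exists u.
  have pol u v : om u (A *m v) = 0.
    have /eqP := q_0 (u + v); rewrite mulmxDr omDl !omDr !q_0 addr0 add0r.
    by rewrite (om_sp v u spA) -mulr2n mulrn_eq0 => /eqP.
  have JA0 : J *m A = 0.
    apply/matrixP => i j; rewrite [RHS]mxE -(pol (delta_mx i 0) (delta_mx j 0)).
    by rewrite /om trmx_delta mulmxA -(mulmxA _ J A) -rowE -colE !mxE.
  by rewrite -[A]mul1mx -[1%:M]opprK -sp_form_sqr mulNmx -mulmxA JA0 mulmx0 oppr0.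
have sq0 v : sq 0 v = 0 by rewrite -(scale0r v) sqZl scale0r.
have sqI : I (sq u u).
  have e0 : - (2%:R * (2%:R * om u (A *m u))) != 0.
    by rewrite oppr_eq0 !mulf_neq0.
  apply: (mx_lie_idealZ_inv IP e0); set y := sq u u.
  have XE : y *m A - A *m y = - (2%:R *: sq (A *m u) u).
    by rewrite -opprB sq_br // (sqC u) scaler_nat mulr2n.
  have yu : y *m u = 0 by rewrite sq_mul om_self scale0r addr0.
  have yAu : y *m (A *m u) = (2%:R * om u (A *m u)) *: u.
    by rewrite sq_mul -scalerDl mulr_natl mulr2n.
  have spy : sp_mx y := sq_sp u u.
  have -> : - (2%:R * (2%:R * om u (A *m u))) *: y =
      y *m (y *m A - A *m y) - (y *m A - A *m y) *m y.
    rewrite XE mulmxN mulNmx -scalemxAr -scalemxAl -opprD -scalerBr sq_br //.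
    by rewrite yu yAu (sqC _ 0) sq0 addr0 sqZl scalerA scaleNr.
  by apply: (I_br) => //; apply: I_br.
have u0 : u != 0 by apply: contraNneq q0 => ->; rewrite mulmx0 /om mulmx0 mxE.
have sq_uI v : I (sq v u).
  have [B spB <-] := sp_transitive v u0.
  have := I_br _ _ spB sqI; rewrite sq_br // sqC -mulr2n -scaler_nat.
  exact: (mx_lie_idealZ_inv IP two0).
have sq_I v w : I (sq v w).
  have [B spB <-] := sp_transitive w u0.
  have := I_br _ _ spB (sq_uI v); rewrite sq_br // => /(mx_lie_idealD IP).
  by move=> /(_ _ (mx_lie_idealN IP (sq_uI (B *m v)))); rewrite addrAC addrN add0r.
move=> B spB.
(* B = M J with M symmetric, so expanding M in matrix units writes B through [sq]. *)
pose M := - (B *m J).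
have trM : M^T = M.
  rewrite /M linearN /= trmx_mul sp_form_tr mulNmx opprK.
  have : J *m (J *m B) *m J = J *m (- (B^T *m J)) *m J by rewrite (sp_mxE spB).
  rewrite mulmxN mulNmx !mulmxA sp_form_sqr -(mulmxA _ J J) sp_form_sqr.
  by rewrite !mulNmx mulmxN mulmx1 mul1mx opprK.
have -> : B = 2%:R^-1 *: \sum_i \sum_j M i j *: sq (delta_mx i 0) (delta_mx j 0).
  have -> : \sum_i \sum_j M i j *: sq (delta_mx i 0) (delta_mx j 0) = (M + M^T) *m J.
    under eq_bigr => i _ do under eq_bigr => j _ do
      rewrite /sq !trmx_delta !mul_delta_mx scalemxAl scalerDr.
    under eq_bigr => i _ do rewrite -mulmx_suml big_split /=.
    rewrite -mulmx_suml big_split /= -matrix_sum_delta; congr ((_ + _) *m J).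
    rewrite exchange_big [RHS]matrix_sum_delta; apply: eq_bigr => i _.
    by apply: eq_bigr => j _; rewrite [M^T _ _]mxE.
  rewrite trM -mulr2n -scaler_nat -scalemxAl scalerA mulVf // scale1r.
  by rewrite /M mulNmx -mulmxA sp_form_sqr mulmxN mulmx1 opprK.
apply: (mx_lie_idealZ IP); apply: (mx_lie_ideal_sum IP IA) => i _.
by apply: (mx_lie_ideal_sum IP IA) => j _; apply: (mx_lie_idealZ IP).
Qed.

End Symplectic.

(** * From matrix algebras to abstract Lie algebras *)

Section Transfer.
Variables (K : numFieldType) (g : lieAlg K) (m : nat) (P : 'M[K]_m -> Prop).
Hypothesis g_isom : lie_isom_mx g P.

Lemma isom_simple : mx_lie_simple P -> simple_lie g.
Proof.
move=> P_simple I I_ideal; have [f [f_inj f_br f_im]] := g_isom.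
have [|/eqP I0] := eqVneq I 0%VS; [by left|right].
pose J A := exists2 x, x \in I & f x = A.
have JP : mx_lie_ideal P J.
  split=> [e _ _ [x xI <-] [y yI <-]|_ [x _ <-]|A _ /f_im[x <-] [y yI <-]].
  - by exists (e *: x + y); rewrite ?memvD ?memvZ // linearP.
  - by apply/f_im; exists x.
  by exists [lie x, y]; rewrite ?f_br // I_ideal.
have v0 : vpick I != 0 by rewrite vpick0; apply/eqP.
apply/eqP; rewrite eqEsubv subvf; apply/subvP => y _.
have fv0 : f (vpick I) != 0.
  by apply: contraNneq v0 => fv; apply/eqP/f_inj; rewrite fv linear0.
have Jv : J (f (vpick I)) by exists (vpick I); rewrite ?memv_pick.
have Pfy : P (f y) by apply/f_im; exists y.
by have [x xI /f_inj <-] := P_simple J JP _ Jv fv0 _ Pfy.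
Qed.

(** The radical of the trace form is an ideal; one pair with nonzero trace makes it proper, hence
    zero. *)
Lemma isom_invariant_form : simple_lie g ->
    (exists A B, [/\ P A, P B & \tr (A *m B) != 0]) ->
  exists B, @invariant_form K g B.
Proof.
move=> g_simple [A [B [PA PB trAB]]]; have [f [f_inj f_br f_im]] := g_isom.
pose T (x y : g) := \tr (f x *m f y).
have T_lin e x y z : T (e *: x + y) z = e * T x z + T y z.
  by rewrite /T linearP mulmxDl -scalemxAl linearP.
have T_sym x y : T x y = T y x by rewrite /T mxtrace_mulC.
have T_br x y z : T [lie x, y] z = T x [lie y, z].
  rewrite /T !f_br mulmxBl mulmxBr !linearB /= !mulmxA; congr (_ - _).
  by rewrite -(mulmxA (f y)) [LHS]mxtrace_mulC.
pose Tl w (x : g) : K^o := T x w.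
have Tl_lin w : linear (Tl w) by move=> e x y; apply: T_lin.
pose TM w := GRing.isLinear.Build _ _ _ _ (Tl w) (Tl_lin w).
pose TL w : {linear g -> K^o} := HB.pack (Tl w) (TM w).
(* Intersecting over a basis presents the radical as a [vspace], to which simplicity applies. *)
pose I := (\bigcap_(i < \dim {:g}) lker (linfun (TL (vbasis {:g})`_i)))%VS.
have memI x : x \in I <-> forall y, T x y = 0.
  split=> [xI y|x0]; last first.
    rewrite memvE; apply/subv_bigcapP => i _.
    by rewrite -memvE memv_ker lfunE /= /Tl x0.
  rewrite T_sym {1}(coord_vbasis (memvf y)) -/(Tl x _) -[Tl x _]/(TL x _) linear_sum.
  rewrite big1 // => i _; rewrite linearZ /= /Tl T_sym.
  have /subv_bigcapP/(_ i isT) : (<[x]> <= I)%VS by rewrite -memvE.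
  by rewrite -memvE memv_ker lfunE /= /Tl => /eqP ->; rewrite scaler0.
exists T; split=> // x x0; have {x0} xI : x \in I by apply/memI.
have [y z /memI z0|I0|I1] := g_simple I; last 2 first.
- by move: xI; rewrite I0 memv0 => /eqP.
- have [a fa] : exists x, f x = A by apply/f_im.
  have [b fb] : exists x, f x = B by apply/f_im.
  have aI : a \in I by rewrite I1 memvf.
  by move: trAB; rewrite -fa -fb -/(T a b) (memI a).1 ?eqxx.
by apply/memI => w; rewrite T_br T_sym T_br z0.
Qed.

Lemma isom_dim_ge (V : vectType K) (f : {linear V -> 'M[K]_m}) :
  injective f -> (forall v, P (f v)) -> (\dim {:V} <= \dim {:g})%N.
Proof.
move=> f_inj Pf; have [h [h_inj _ h_im]] := g_isom.
have kf : lker (linfun f) == 0%VS by apply/lker0P => x y; rewrite !lfunE => /f_inj.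
have kh : lker (linfun h) == 0%VS by apply/lker0P => x y; rewrite !lfunE => /h_inj.
rewrite -(limg_dim_eq (f := linfun f)) ?(eqP kf) ?capv0 //.
rewrite -[X in (_ <= X)%N](limg_dim_eq (f := linfun h)) ?(eqP kh) ?capv0 //.
apply: dimvS; apply/subvP => _ /memv_imgP[v _ ->]; rewrite lfunE /=.
have [x <-] := (h_im _).1 (Pf v); rewrite -[h x]/(h x) -(lfunE h).
by rewrite memv_img ?memvf.
Qed.

Lemma isom_dim_vspace (U : {vspace 'M[K]_m}) :
  (forall A, P A <-> A \in U) -> \dim {:g} = \dim U.
Proof.
move=> PU; have [h [h_inj _ h_im]] := g_isom.
have kh : lker (linfun h) == 0%VS by apply/lker0P => x y; rewrite !lfunE => /h_inj.
rewrite -(limg_dim_eq (f := linfun h)) ?(eqP kh) ?capv0 //; congr (\dim _).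
apply/eqP; rewrite eqEsubv; apply/andP; split; apply/subvP => A.
  by case/memv_imgP => x _ ->; rewrite lfunE /=; apply/PU/h_im; exists x.
by move=> /PU/h_im[x <-]; rewrite -(lfunE h) memv_img ?memvf.
Qed.

End Transfer.

(** * Dimensions of the classical algebras *)

Section Dimensions.
Variable K : numFieldType.

Lemma dim_sl (g : lieAlg K) m : isom_sl g m.+1 -> (\dim {:g}).+1 = (m.+1 * m.+1)%N.
Proof.
move=> g_isom; pose f : 'M[K]_m.+1 -> K^o := @mxtrace K m.+1.
have f_lin : linear f by move=> e A B; rewrite /f linearP.
pose fM := GRing.isLinear.Build _ _ _ _ f f_lin.
pose fL : {linear 'M[K]_m.+1 -> K^o} := HB.pack f fM.
rewrite (isom_dim_vspace g_isom (U := lker (linfun fL))); last first.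
  by move=> A; rewrite memv_ker lfunE /=; split=> [A0|/eqP //]; apply/eqP.
have dE := limg_ker_dim (linfun fL) fullv; rewrite capfv in dE.
transitivity (\dim {: 'M[K]_m.+1}); last by rewrite dimvf; apply: dim_matrix.
rewrite -dE.
have -> : limg (linfun fL) = fullv.
  apply/eqP; rewrite eqEsubv subvf; apply/subvP => e _.
  have -> : e = linfun fL (e *: delta_mx 0 0).
    rewrite lfunE /= /f linearZ /= /mxtrace (bigD1 ord0) //= mxE !eqxx.
    rewrite big1 ?addr0 ?mulr1 // => i i0.
    by rewrite mxE (negPf i0).
  by rewrite memv_img ?memvf.
by rewrite dimvf /dim /= addn1.
Qed.

Lemma card_lt_pairs m : #|[pred p : 'I_m * 'I_m | (p.1 < p.2)%N]| = 'C(m, 2).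
Proof.
rewrite -sum1_card -(pair_big_dep xpredT (fun i j : 'I_m => i < j)%N (fun _ _ => 1%N)) /=.
rewrite (exchange_big_dep xpredT) //= -bin2_sum big_mkord; apply: eq_bigr => j _.
by rewrite -(big_ord_widen m (fun=> 1%N) (ltnW (ltn_ord j))) sum1_card card_ord.
Qed.

Lemma dim_so (g : lieAlg K) m : isom_so g m -> \dim {:g} = 'C(m, 2).
Proof.
move=> g_isom; rewrite -card_lt_pairs -card_sig.
pose I : finType := ({p : 'I_m * 'I_m | (p.1 < p.2)%N})%type.
have [f [f_inj f_br f_im]] := g_isom.
apply/eqP; rewrite eqn_leq; apply/andP; split.
  pose z (k : I) (x : g) : K^o := f x (val k).1 (val k).2.
  have z_lin k : linear (z k) by move=> e x y; rewrite /z linearP !mxE.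
  pose zM k := GRing.isLinear.Build _ _ _ _ (z k) (z_lin k).
  pose zL k : {linear g -> K^o} := HB.pack (z k) (zM k).
  have := @joint_injective_dim _ _ I (fun k => linfun (zL k)); apply=> x x0.
  have so_fx : so_mx (f x) by apply/f_im; exists x.
  have lt0 (i j : 'I_m) : (i < j)%N -> f x i j = 0.
    by move=> ij; have := x0 (Sub (i, j) ij : I); rewrite lfunE.
  apply: f_inj; rewrite linear0; apply/matrixP => i j; rewrite mxE.
  case: (ltngtP i j) => [/lt0 //|/lt0 e|/val_inj ->]; first by rewrite so_mxE // e oppr0.
  by have /eqP := so_mxE j j so_fx; rewrite -addr_eq0 -mulr2n mulrn_eq0 => /eqP.
have /choice[v vE] : forall k : I, exists x : g, f x = so_gen K (val k).1 (val k).2.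
  by move=> k; apply/f_im/so_gen_so.
have entry (p q : I) :
    so_gen K (val q).1 (val q).2 (val p).1 (val p).2 = (q == p)%:R.
  rewrite -val_eqE /so_gen subr_mxE !mxE.
  case: p q => -[p1 p2] /= p_lt [[q1 q2] /= q_lt].
  rewrite xpair_eqE (eq_sym p1) (eq_sym p2) [X in _ - X](_ : _ = 0) ?subr0 //.
  case: eqP => // /(congr1 val) /= e1; case: eqP => // /(congr1 val) /= e2.
  by exfalso; lia.
apply: (@independent_dim _ _ _ v) => k k0 p.
have /(congr1 f)/matrixP/(_ (val p).1 (val p).2) := k0.
rewrite linear0 linear_sum [RHS]mxE summxE => <-.
rewrite (bigD1 p) //= linearZ /= vE mxE entry eqxx mulr1 big1 ?addr0 // => q qp.
by rewrite linearZ /= vE mxE entry (negPf qp) mulr0.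
Qed.

(** Block triangular matrices with diagonal upper right block suffice: n^2 + n is already 12 for n =
    3, above the bound 11. *)
Lemma dim_sp (g : lieAlg K) n : isom_sp g n -> (n * n + n <= \dim {:g})%N.
Proof.
move=> g_isom.
pose f (v : 'M[K]_n * 'rV[K]_n) : 'M[K]_(n + n) :=
  block_mx v.1 (diag_mx v.2) 0 (- v.1^T).
have f_lin : linear f.
  move=> e u v; rewrite /f scale_block_mx add_block_mx !linearP /= !scaler0 addr0.
  by [].
pose fM := GRing.isLinear.Build _ _ _ _ f f_lin.
pose fL : {linear ('M[K]_n * 'rV[K]_n)%type -> 'M[K]_(n + n)} := HB.pack f fM.
have <- : \dim {: ('M[K]_n * 'rV[K]_n)%type} = (n * n + n)%N.
  rewrite dimvf; transitivity (dim 'M[K]_n + dim 'rV[K]_n)%N => //.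
  exact: (f_equal2 addn (dim_matrix K n n) (etrans (dim_matrix K 1 n) (mul1n n))).
apply: (isom_dim_ge g_isom (f := fL)) => [[A b] [A' b'] /= /eq_block_mx[eA e _ _]|[A b]].
  congr (_, _); first exact: eA. apply/rowP => i.
  by have /matrixP/(_ i i) := e; rewrite !mxE eqxx !mulr1n.
rewrite /sp_mx /= /f /sp_form tr_block_mx !mulmx_block.
rewrite !(mul0mx, mulmx0, mulmx1, mul1mx, addr0, add0r, mulNmx, mulmxN).
rewrite add_block_mx !tr_diag_mx trmx0 linearN /= trmxK oppr0 !addr0 !opprK.
by rewrite !subrr block_mx0.
Qed.

Lemma mxtrace_delta m (i : 'I_m) : \tr (delta_mx i i : 'M[K]_m) = 1.
Proof.
rewrite /mxtrace (bigD1 i) //= mxE !eqxx big1 ?addr0 // => j ji.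
by rewrite mxE (negPf ji).
Qed.

Lemma mxtrace_delta_neq m (i j : 'I_m) : i != j -> \tr (delta_mx i j : 'M[K]_m) = 0.
Proof.
move=> ij; rewrite /mxtrace big1 // => k _; rewrite mxE.
by case: eqP => // ->; rewrite (negPf ij).
Qed.

Lemma mxtrace_so_gen m (i j : 'I_m) : i != j ->
  \tr (so_gen K i j *m so_gen K i j) = - 2%:R.
Proof.
move=> ij; rewrite /so_gen mulmxBl !mulmxBr !mul_delta_mx_cond !eqxx.
rewrite [j == i]eq_sym (negPf ij) !mulr0n !mulr1n !(subr0, sub0r).
by rewrite linearB linearN /= !mxtrace_delta -opprD.
Qed.

Lemma classical_invariant_form (g : lieAlg K) : classical_simple g ->
  simple_lie g /\ exists B, @invariant_form K g B.
Proof.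
have so_case m : (5 <= m)%N -> isom_so g m ->
    simple_lie g /\ exists B, @invariant_form K g B.
  move=> m5 g_isom; have g_simple := isom_simple g_isom (so_mx_simple m5).
  split=> //; apply: (isom_invariant_form g_isom g_simple).
  case: m m5 g_isom => [|[|m]] // _ _; pose F := so_gen K (@ord0 m.+1) ord_max.
  by exists F, F; split; [exact: so_gen_so..|rewrite mxtrace_so_gen ?oppr_eq0 ?pnatr_eq0].
case=> [[n n1 g_isom]|[n n2]|[n n3 g_isom]|[n n4]].
- have g_simple := isom_simple g_isom (@sl_mx_simple K n.+1).
  split=> //; apply: (isom_invariant_form g_isom g_simple).
  case: n n1 {g_isom} => [|n] // _.
  exists (delta_mx ord0 ord_max), (delta_mx ord_max ord0); split.
  + by rewrite /sl_mx mxtrace_delta_neq.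
  + by rewrite /sl_mx mxtrace_delta_neq.
  by rewrite mul_delta_mx mxtrace_delta oner_eq0.
- by apply: so_case; lia.
- have g_simple := isom_simple g_isom (@sp_mx_simple K n).
  split=> //; apply: (isom_invariant_form g_isom g_simple).
  pose D : 'M[K]_(n + n) := block_mx 1%:M 0 0 (- 1%:M).
  have D_sp : sp_mx D.
    rewrite /sp_mx /D /sp_form tr_block_mx !mulmx_block linearN /= !trmx0 !trmx1.
    rewrite !(mul0mx, mulmx0, mulmx1, mul1mx, addr0, add0r, mulNmx, mulmxN).
    by rewrite add_block_mx !addr0 linearN /= trmx1 opprK oppr0 !subrr block_mx0.
  exists D, D; split=> //; rewrite /D mulmx_block.
  rewrite !(mul0mx, mulmx0, mulmx1, mul1mx, addr0, add0r, mulNmx, mulmxN).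
  by rewrite opprK -scalar_mx_block mxtrace1 pnatr_eq0; lia.
by apply: so_case; lia.
Qed.

(** The lower bound removes sl(2), of dimension 3. The first algebras beyond the two survivors are
    sl(4), so(7), so(8), of dimensions 15, 21, 28, and sp(6), of dimension at least 12. *)
Lemma classical_dim (g : lieAlg K) : classical_simple g ->
  (3 < \dim {:g} <= 11)%N -> isom_sl g 3 \/ isom_so g 5.
Proof.
case=> [[n n1 g_isom]|[n n2 g_isom]|[n n3 g_isom]|[n n4 g_isom]] /andP[d3 d11].
- have := dim_sl g_isom; case: n n1 g_isom => [|[|[|n]]] // _ g_isom.
  + by move=> e; move: d3; lia.
  + by left.
  by move=> e; exfalso; nia.
- have := dim_so g_isom; case: n n2 g_isom => [|[|[|n]]] // _ g_isom; first by right.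
  have /(leq_bin2l 2) b : (7 <= (2 * n.+3).+1)%N by lia.
  by move=> e; exfalso; move: d11; rewrite e leqNgt (leq_trans _ b).
- by have := dim_sp g_isom; nia.
have := dim_so g_isom.
have /(leq_bin2l 2) b : (8 <= 2 * n)%N by lia.
by move=> e; exfalso; move: d11; rewrite e leqNgt (leq_trans _ b).
Qed.

End Dimensions.

(** * The nilradical *)

Section TriangularNilpotent.
Variables (K : numFieldType) (L : lieAlg K) (d : nat) (e : d.-tuple L).
Hypothesis e_tri : triangular_basis e.

Lemma lower_central_triangular i u (k : 'I_d) :
  u \in lower_central L i -> (k < i)%N -> coord e k u = 0.
Proof.
elim: i u k => // i IHi u k ui ki.
have : u \in lker (linfun (coord e k : L -> K^o)); last first.
  by rewrite memv_ker lfunE => /eqP.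
apply: subvP u ui => /=; apply: lie_comm_sub => v w _ wi.
rewrite memv_ker lfunE /= (coord_br _ _ _ e_tri.1).
apply/eqP; apply: big1 => j _; apply: big1 => l _.
have [li|il] := ltnP l i; first by rewrite (IHi w l wi li) mulr0 mul0r.
by rewrite e_tri.2 ?mulr0 // leq_max (leq_trans _ il) ?orbT.
Qed.

Lemma triangular_nilpotent : (0 < d)%N -> exists k, nilpotency_index L k.
Proof.
move=> d_gt0.
have ex_k : exists k, lower_central L k == 0%VS.
  exists d; rewrite -subv0; apply/subvP => u ud; rewrite memv0; apply/eqP.
  by apply: (basis_coord_inj e_tri.1) => k; apply: lower_central_triangular ud _.
have [k /eqP k0 k_min] := ex_minnP ex_k.
have k_gt0 : (0 < k)%N.
  rewrite lt0n; apply/eqP => k_eq0; move: k0; rewrite k_eq0 /= => /(congr1 (@dimv _ _)).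
  by rewrite (size_basis e_tri.1) dimv0 => d0; rewrite d0 in d_gt0.
exists k; split=> // /eqP k1; have := k_min _ k1.
by rewrite leqNgt prednK ?leqnn.
Qed.

End TriangularNilpotent.

(** * Transfer between the root vectors of g and the real basis of n *)

Section Nilradical.
Variables (R : realType) (g : lieAlg R[i]) (n : lieAlg R).
Variable B : g -> g -> R[i].
Hypotheses (B_inv : invariant_form B) (g_simple : simple_lie g).
Variables (h : {vspace g}) (d : nat) (alpha : d.-tuple (dual (subvs_of h))).
Variables (X : 'I_d -> g) (c : 'I_d -> 'I_d -> 'I_d -> R) (x : d.-tuple n).
Hypothesis h_cartan : cartan_subalgebra h.
Hypothesis alpha_uniq : uniq alpha.
Hypothesis alpha_pos : positive_system (fun a => a \in alpha).
Hypothesis X_span :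
  forall i y, in_root_space (tnth alpha i) y <-> y \in <[X i]>%VS.
Hypothesis X_br : forall i j, [lie X i, X j] = \sum_(k < d) (c i j k)%:C%C *: X k.
Hypothesis x_basis : basis_of fullv x.
Hypothesis x_br : forall i j,
  [lie tnth x i, tnth x j] = \sum_(k < d) c i j k *: tnth x k.
Notation a := (tnth alpha).

Let exists_Y : exists Y : 'I_d -> g,
  (forall i, in_root_space (- a i) (Y i)) /\ (forall i, B (X i) (Y i) = 1).
Proof.
have /choice[Y YP] := neg_vec_exists B_inv h_cartan alpha_pos X_span.
by exists Y; split=> i; have [] := YP i.
Qed.

Lemma nilradical_support i j k : c i j k != 0 -> a k = a i + a j.
Proof.
have [Y [Y_neg XY]] := exists_Y => cijk.
apply: (structure_constant_support B_inv alpha_uniq X_span Y_neg XY (X_br i j)).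
by rewrite fmorph_eq0.
Qed.

Lemma tnth_coord (i : 'I_d) (j : 'I_d) : coord x i (tnth x j) = (i == j)%:R.
Proof.
by rewrite (tnth_nth 0) coord_free ?(basis_free x_basis) // eq_sym.
Qed.

(** The basis is sorted by height, which brackets of root vectors strictly increase. *)
Lemma nilradical_triangular : exists e : d.-tuple n, triangular_basis e.
Proof.
have [Y [Y_neg XY]] := exists_Y.
have ht_lt := height_lt B_inv g_simple h_cartan alpha_pos X_span Y_neg XY.
pose ht := height alpha.
pose s := sort (fun i j => ht i <= ht j)%N (enum 'I_d).
have s_perm : perm_eq s (enum 'I_d) by rewrite perm_sort.
have s_size : size s == d by rewrite (perm_size s_perm) size_enum_ord.
pose st : d.-tuple 'I_d := Tuple s_size.
have st_inj : injective (tnth st).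
  by apply/tuple_uniqP; rewrite (perm_uniq s_perm) enum_uniq.
have s_sorted (i j : 'I_d) : (ht (tnth st i) < ht (tnth st j))%N -> (i < j)%N.
  apply: contraTT; rewrite -!leqNgt => ji.
  have ht_total : total (fun i j => ht i <= ht j)%N by move=> u v; apply: leq_total.
  have ht_trans : transitive (fun i j => ht i <= ht j)%N.
    by move=> u v w; apply: leq_trans.
  rewrite !(tnth_nth i); apply: (sorted_leq_nth ht_trans _ i (sort_sorted ht_total _));
    rewrite ?inE ?(eqP s_size) //.
pose e := [tuple of map (tnth x) st].
have e_basis : basis_of fullv e.
  have ex : perm_eq e x.
    by rewrite -[X in perm_eq _ X]map_tnth_enum; apply: perm_map.
  by rewrite (perm_basis _ ex).
have eE (i : 'I_d) : e`_i = tnth x (tnth st i) by rewrite -tnth_nth tnth_map.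
exists e; split=> // i j k; apply: contraTeq => cijk.
have : c (tnth st i) (tnth st j) (tnth st k) != 0.
  apply: contraNneq cijk => c0; rewrite !eE x_br linear_sum big1 // => l _.
  have [k' ->] : exists k', l = tnth st k'.
    by exists (invF st_inj l); rewrite f_invF.
  rewrite linearZ /= -eE coord_free ?(basis_free e_basis) //.
  by have [->|_] := eqVneq k' k; rewrite ?c0 ?mul0r ?mulr0.
move=> /nilradical_support ak; rewrite -ltnNge gtn_max.
apply/andP; split; apply: s_sorted; first exact: ht_lt ak.
by rewrite addrC in ak; apply: ht_lt ak.
Qed.

Lemma nilradical_dim : (0 < d)%N ->
  exists r, (0 < r <= d)%N /\ \dim {:g} = (r + 2 * d)%N.
Proof.
move=> d_gt0; have [Y [Y_neg XY]] := exists_Y; exists (\dim h); split.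
  rewrite (rank_gt0 alpha_pos d_gt0).
  exact: (rank_le g_simple h_cartan alpha_pos X_span).
exact: (dim_roots B_inv h_cartan alpha_uniq alpha_pos X_span Y_neg XY).
Qed.

(** For fixed j the roots a_l + a_j are distinct, so the terms of [z, x_j] do not mix: its
    coordinate along a_i + a_j is z_i times a structure constant. *)
Lemma central_coord z i : (forall y, [lie z, y] = 0) -> coord x i z != 0 ->
  forall j, [lie X i, X j] = 0.
Proof.
move=> zc zi j; rewrite X_br big1 // => k _.
suff -> : c i j k = 0 by rewrite rmorph0 scale0r.
apply/eqP; apply: contraT => cijk.
have := congr1 (coord x k) (zc (tnth x j)); rewrite linear0.
rewrite (coord_basis x_basis (memvf z)) lie_br_suml linear_sum.
have cE l : coord x k [lie coord x l z *: x`_l, tnth x j] = coord x l z * c l j k.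
  rewrite lie_brZl linearZ /= -tnth_nth x_br linear_sum (bigD1 k) //=.
  rewrite linearZ /= tnth_coord eqxx mulr1 big1 ?addr0 // => k' kk'.
  by rewrite linearZ /= tnth_coord eq_sym (negPf kk') mulr0.
rewrite (eq_bigr _ (fun l _ => cE l)) (bigD1 i) //= big1 ?addr0 => [/eqP|l li].
  by rewrite mulf_eq0 (negPf zi) (negPf cijk).
have [->|clj] := eqVneq (c l j k) 0; first by rewrite mulr0.
case/eqP: li; apply: (pos_root_inj alpha_uniq); apply: (addIr (a j)).
by rewrite -(nilradical_support clj) -(nilradical_support cijk).
Qed.

Lemma nilradical_cocycle_dim (w : n -> n -> R) z y :
    alternating w -> cocycle w -> (forall u, [lie z, u] = 0) -> w z y != 0 ->
  (\dim {:g} <= 11)%N.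
Proof.
move=> w_alt w_cl zc wzy; have [Y [Y_neg XY]] := exists_Y.
have [t [zt wty]] : exists t, coord x t z != 0 /\ w (tnth x t) y != 0.
  apply: contrapT => /forallNP Nt; case/eqP: wzy.
  rewrite (coord_basis x_basis (memvf z)) alt_suml // big1 // => i _.
  rewrite altZl // -tnth_nth; apply/eqP; rewrite mulf_eq0.
  by apply/norP/(Nt i).
have Xt := central_coord zc zt.
pose S := half_set alpha X Y t; pose s := half_dual alpha t.
have sum_s := half_dual_sum B_inv g_simple h_cartan alpha_uniq alpha_pos X_span Y_neg XY Xt.
have sS := half_dual_in B_inv g_simple h_cartan alpha_uniq alpha_pos X_span Y_neg XY Xt.
have sK := half_dualK B_inv g_simple h_cartan alpha_uniq alpha_pos X_span Y_neg XY Xt.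
have br_s_neq0 :=
  half_dual_br B_inv g_simple h_cartan alpha_uniq alpha_pos X_span Y_neg XY Xt.
have S_sum := half_sum B_inv g_simple h_cartan alpha_uniq alpha_pos X_span Y_neg XY Xt.
have S_translate :=
  half_translate B_inv g_simple h_cartan alpha_uniq alpha_pos X_span Y_neg XY Xt.
have dim_le :=
  dim_le_half B_inv g_simple h_cartan alpha_uniq alpha_pos X_span Y_neg XY Xt.
rewrite -/S in sum_s sS sK br_s_neq0 S_sum S_translate dim_le.
rewrite -/s in sum_s sS sK br_s_neq0.
(* Two roots of degree 1 give at most 3 + 4 + 4 = 11. *)
have [S_le2|S_gt2] := leqP #|S| 2.
  by apply: leq_trans dim_le _; move: S_le2; case: (#|S|) => [|[|[|]]].
case/eqP: wty; clear dim_le.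
pose N i := c i (s i) t.
have c_t i k : i \in S -> k != t -> c i (s i) k = 0.
  move=> iS kt; apply/eqP; apply: contraT => /nilradical_support.
  by rewrite sum_s // => /(pos_root_inj alpha_uniq) /eqP; rewrite (negPf kt).
have xt0 : tnth x t != 0.
  apply/eqP => xt0; have /eqP := tnth_coord t t.
  by rewrite xt0 linear0 eqxx eq_sym oner_eq0.
have N_neq0 : {in S, forall i, N i != 0}.
  move=> i iS; apply: contraNneq (br_s_neq0 i iS) => Ni0.
  rewrite X_br big1 // => k _; have [->|kt] := eqVneq k t.
    by rewrite -/(N i) Ni0 rmorph0 scale0r.
  by rewrite c_t // rmorph0 scale0r.
have br_s : {in S, forall i, [lie tnth x i, tnth x (s i)] = N i *: tnth x t}.
  move=> i iS; rewrite x_br (bigD1 t) //= big1 ?addr0 // => k kt.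
  by rewrite c_t ?scale0r.
have br_neq_s : {in S &, forall i j, j != s i -> [lie tnth x i, tnth x j] = 0}.
  move=> i j iS jS js; rewrite x_br big1 // => k _.
  have [->|/nilradical_support e] := eqVneq (c i j k) 0; first by rewrite scale0r.
  case/eqP: js; apply: (pos_root_inj alpha_uniq); apply: (addrI (a i)).
  by rewrite sum_s // -e (S_sum i j k iS jS e).
have sSin : {in S, forall i, s i \in S} by move=> i; apply: sS.
have sKin : {in S, involutive s} by move=> i; apply: sK.
have wt j : w (tnth x t) (tnth x j) = 0.
  have [jS|jS] := boolP (j \in S).
    exact: (cocycle_heisenberg_self sSin sKin N_neq0 br_s br_neq_s w_alt w_cl S_gt2 jS).
  have [->|jt] := eqVneq j t; first exact: altxx w_alt _.
  (* Centrality of X_t in terms of root vectors of g is read on structure constants by pairing with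
     Y_k, and so passes to n. *)
  have xtj : [lie tnth x t, tnth x j] = 0.
    rewrite x_br big1 // => k _.
    have := congr1 (fun u => B u (Y k)) (Xt j).
    rewrite X_br (inv_sumXY B_inv alpha_uniq X_span Y_neg XY) (inv0l B_inv) => /eqP.
    by rewrite fmorph_eq0 => /eqP ->; rewrite scale0r.
  apply: (cocycle_heisenberg_normalizer xt0 sSin sKin N_neq0 br_s br_neq_s w_alt w_cl
    (A := fun l b => c j b l) xtj); last exact: ltn_trans S_gt2.
  move=> b bS; rewrite x_br [LHS](bigID (mem S)) /= [X in _ + X]big1 ?addr0 // => l lS.
  have [->|/nilradical_support e] := eqVneq (c j b l) 0; first by rewrite scale0r.
  by case/negP: lS; apply: (S_translate j b l jt jS bS e).
rewrite (coord_basis x_basis (memvf y)) alt_sumr // big1 // => i _.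
by rewrite altZr // -tnth_nth wt mulr0.
Qed.

End Nilradical.

Section SymplecticExtension.
Variables (K : numFieldType) (L : lieAlg K) (s : nat).
Notation E := (trivial_extension s L).
Let inL (u : L) : E := (0, u).
Let inA (r : 'rV[K]_s) : E := (r, 0).

Lemma symplectic_extension_restrict :
    symplectic E -> exists b, [/\ alternating b, cocycle b &
      forall i z, z \in lower_central L i.+1 -> (forall u, [lie z, u] = 0) ->
        z != 0 -> exists y, b z y != 0].
Proof.
case=> w [w_form w_closed w_nondeg].
have w_alt := form_alternating w_form.
have w_cl : cocycle (eval2 w) by apply/(closed_form_eval2 w_form).
have inL_lin a u v : inL (a *: u + v) = a *: inL u + inL v.
  by rewrite /inL; congr (_, _); rewrite /= scaler0 addr0.
have inL_br u v : inL [lie u, v] = [lie inL u, inL v] by [].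
exists (fun u v => eval2 w (inL u) (inL v)); split.
- split=> [a u v y|a u v y|u]; rewrite ?inL_lin.
  + exact: alt_linearl.
  + exact: alt_linearr.
  exact: altxx.
- by move=> u v y; rewrite !inL_br w_cl.
move=> i z zi zc z0.
(* On u, v and r in the abelian factor, the cocycle identity reduces to w([u, v], r) = 0; such
   brackets span [L, L], which contains z. *)
have wzA r : eval2 w (inL z) (inA r) = 0.
  pose f (u : L) : K^o := eval2 w (inL u) (inA r).
  have f_lin : linear f by move=> a u v; rewrite /f inL_lin (alt_linearl w_alt).
  pose fM := GRing.isLinear.Build _ _ _ _ f f_lin.
  pose fL : {linear L -> K^o} := HB.pack f fM.
  suff /subvP/(_ z zi) : (lower_central L i.+1 <= lker (linfun fL))%VS.
    by rewrite memv_ker lfunE => /eqP.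
  apply: lie_comm_sub => u v _ _; rewrite memv_ker lfunE /= /f inL_br.
  have := w_cl (inL u) (inL v) (inA r).
  have -> : [lie inL v, inA r] = 0.
    by congr (_, _); rewrite /= lie_br0r.
  have -> : [lie inA r, inL u] = 0.
    by congr (_, _); rewrite /= lie_br0l.
  by rewrite !(alt0l w_alt) !addr0 => ->.
apply: contrapT => /forallNP Nz; case/eqP: z0.
suff /(congr1 snd) : inL z = 0 by [].
apply: w_nondeg => -[r v].
have -> : (r, v) = inA r + inL v by congr (_, _); rewrite ?addr0 ?add0r.
rewrite (altDr w_alt) wzA add0r; apply/eqP; apply: contraT => wzv.
by case: (Nz v).
Qed.

End SymplecticExtension.

(** Serves nilpotency index 1, where the last nonzero term is the whole algebra and is not contained
    in [n, n]. *)
Lemma abelian_form (K : numFieldType) (L : lieAlg K) : (2 <= \dim {:L})%N ->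
    (forall u v : L, [lie u, v] = 0) ->
  exists b : L -> L -> K, [/\ alternating b, cocycle b & exists z y, b z y != 0].
Proof.
move=> d2 ab; set d := \dim _ in d2; pose e := vbasis {:L}.
pose i := Ordinal (ltnW d2); pose j := Ordinal d2.
pose b (u v : L) := coord e i u * coord e j v - coord e j u * coord e i v.
exists b; split.
- split=> [a u v w|a u v w|u]; rewrite /b ?linearP /=; by ring.
- by move=> u v w; rewrite !ab /b !linear0; ring.
exists e`_i, e`_j; rewrite /b !coord_free ?(basis_free (vbasisP _)) //.
by rewrite !eqxx /= mulr0 mulr1 subr0 oner_eq0.
Qed.

(** * The three implications *)

Section Main.
Variables (R : realType) (g : lieAlg R[i]) (n : lieAlg R).
Hypotheses (hg : classical_simple g) (hn : split_nilradical g n).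
Hypothesis hdim : (2 <= \dim {:n})%N.

Lemma nilradical_basis : exists e : (\dim {:n}).-tuple n, triangular_basis e.
Proof.
have [g_simple [B B_inv]] := classical_invariant_form hg.
have [h [d [alpha [X [c [x [h_cartan [a_uniq a_pos] X_span X_br [xb x_br]]]]]]]] := hn.
rewrite (size_basis xb).
exact: (nilradical_triangular B_inv g_simple h_cartan a_uniq a_pos X_span X_br xb x_br).
Qed.

Lemma dim_classical_nilradical :
  exists r, (0 < r <= \dim {:n})%N /\ \dim {:g} = (r + 2 * \dim {:n})%N.
Proof.
have [g_simple [B B_inv]] := classical_invariant_form hg.
have [h [d [alpha [X [c [x [h_cartan [a_uniq a_pos] X_span X_br [xb x_br]]]]]]]] := hn.
have dE := size_basis xb; rewrite dE.
apply: (nilradical_dim B_inv g_simple h_cartan a_uniq a_pos X_span).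
by rewrite -dE; apply: ltnW.
Qed.

Lemma symplectic_E_infty :
    (forall s, ~~ odd (s + \dim {:n}) -> symplectic (trivial_extension s n)) ->
  exists2 k, nilpotency_index n k & E_infty_neq0 n k 0 2.
Proof.
have two_neq0 : 2%:R != 0 :> R by rewrite pnatr_eq0.
have [e e_tri] := nilradical_basis.
have [k nk] := triangular_nilpotent e_tri (ltnW hdim).
move=> sym; exists k => //; have [k_gt0 k0 /eqP k1] := nk.
have [k_eq1|k_gt1] := eqVneq k 1%N.
  have ab (u v : n) : [lie u, v] = 0.
    by apply: (lower_central_last v nk); rewrite k_eq1 memvf.
  have [b [b_alt b_cl [z [y bzy]]]] := abelian_form hdim ab.
  by apply: (E_infty_neq0_intro two_neq0 nk b_alt b_cl _ bzy); rewrite k_eq1 memvf.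
(* A single extension suffices: s is the parity of dim n. *)
have [|b [b_alt b_cl b_z]] := symplectic_extension_restrict (sym (odd (\dim {:n})) _).
  by rewrite oddD oddb addbb.
pose z := vpick (lower_central n k.-1).
have zk : z \in lower_central n k.-1 by apply: memv_pick.
have z0 : z != 0 by rewrite vpick0.
have zc u : [lie z, u] = 0 by exact: lower_central_last u nk zk.
have zk' : z \in lower_central n k.-2.+1 by rewrite prednK //; lia.
have [y bzy] := b_z _ z zk' zc z0.
exact: (E_infty_neq0_intro two_neq0 nk b_alt b_cl zk bzy).
Qed.

Lemma E_infty_classification :
    (exists2 k, nilpotency_index n k & E_infty_neq0 n k 0 2) ->
  isom_sl g 3 \/ isom_so g 5.
Proof.
have two_neq0 : 2%:R != 0 :> R by rewrite pnatr_eq0.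
case=> k nk /(E_infty_neq0_elim two_neq0 nk)[b [z [y [b_alt b_cl zk bzy]]]].
apply: (classical_dim hg); apply/andP; split.
  by have [r [r_bnd ->]] := dim_classical_nilradical; lia.
have [g_simple [B B_inv]] := classical_invariant_form hg.
have [h [d [alpha [X [c [x [h_cartan [a_uniq a_pos] X_span X_br [xb x_br]]]]]]]] := hn.
apply: (nilradical_cocycle_dim B_inv g_simple h_cartan a_uniq a_pos X_span X_br xb x_br
  b_alt b_cl _ bzy) => u.
exact: lower_central_last u nk zk.
Qed.

Lemma classification_symplectic : isom_sl g 3 \/ isom_so g 5 ->
  forall s, ~~ odd (s + \dim {:n}) -> symplectic (trivial_extension s n).
Proof.
have [r [r_bnd rE]] := dim_classical_nilradical.
have [e e_tri] := nilradical_basis.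
have sum_sqr0 (p q : R) : p ^+ 2 + q ^+ 2 = 0 -> p = 0 /\ q = 0.
  move=> /eqP; rewrite paddr_eq0 ?sqr_ge0 // !sqrf_eq0.
  by case/andP=> /eqP -> /eqP ->.
case=> [/dim_sl|/dim_so] dg s; rewrite oddD; rewrite rE in dg.
  (* With 0 < r <= d, the equation 8 = r + 2 d leaves d = 3; in the other case 10 = r + 2 d leaves d
     = 4. *)
  have d3 : \dim {:n} = 3%N by lia.
  move: e e_tri; rewrite d3 => e e_tri s_odd.
  by apply: dim3_symplectic e_tri _; rewrite -[odd s]negbK; move: s_odd; case: odd.
have d4 : \dim {:n} = 4%N by rewrite (_ : 'C(5, 2) = 10)%N // in dg; lia.
move: e e_tri; rewrite d4 => e e_tri s_even.
by apply: dim4_symplectic sum_sqr0 e_tri _; move: s_even; case: odd.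
Qed.

End Main.

Theorem corollary4p3 (R : realType) (g : lieAlg R[i]) (n : lieAlg R)
    (hg : classical_simple g) (hn : split_nilradical g n)
    (hdim : (2 <= \dim (fullv : {vspace n}))%N) :
  ((forall s : nat, ~~ odd (s + \dim (fullv : {vspace n}))%N ->
      symplectic (trivial_extension s n))
    <-> (exists2 k : nat, nilpotency_index n k & E_infty_neq0 n k 0 2))
  /\
  ((exists2 k : nat, nilpotency_index n k & E_infty_neq0 n k 0 2)
    <-> (isom_sl g 3 \/ isom_so g 5)).
Proof.
have s1 := symplectic_E_infty hg hn hdim.
have s2 := E_infty_classification hg hn hdim.
have s3 := classification_symplectic hg hn hdim.
by split; [split=> [/s1|/s2/s3]|split=> [/s2|/s3/s1]].
Qed.
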